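(* Let $\varepsilon>0$, $f\in\mathbb R[x]_{2d}$ and $g_i\in\mathbb R[x]_{2d_i}$ for $i=0,\dots,m$, with $g_0=1$, and let $k\ge\max\{d,d_0,\dots,d_m\}$. Let $S(g)=\{x\in\mathbb R^n: g_i(x)\ge0,\ i=1,\dots,m\}$, $f^\star=\inf_{x\in S(g)}f(x)$, and let $\lambda_k$ be the value of the order-$k$ sum-of-squares relaxation. Suppose that: (a) there exist $\underline\lambda\in\mathbb R$ and a positive measure $\mu$ supported on $S(g)$ with $\underline\lambda\le\lambda_k$ and $\int(f-\underline\lambda)\,d\mu\,/\,\lambda_{\min}(D_k(g\mu))\le 1$; (b) $\|g_i\|_{\ell_1}\le1$ for $i=1,\dots,m$. Assume strong duality holds for the order-$k$ sum-of-squares and moment relaxations, and that $\lambda_k=f^\star$. Suppose further that the problem $\inf_{x\in S(g)}f(x)$ has an optimal solution $x^\star$ with $\|x^\star\|_{\ell_1}\le r$, where $r\in(0,1)$. Let $\lambda_k^{(\varepsilon)}$ be the value returned by the algorithm CON (described in the context), run with $\varepsilon$, $\underline\lambda$ and a point $a\in S(g)$. Then $$0\le\lambda_k^{(\varepsilon)}-\lambda_k\le\varepsilon\left(2+\frac{r}{1-r}\right).$$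
   Context: Notation. $\mathbb N^n_t=\{\alpha\in\mathbb N^n:|\alpha|\le t\}$; $\mathbb R[x]_t$: real polynomials in $x=(x_1,\dots,x_n)$ of degree at most $t$; $f=\sum f_\alpha x^\alpha$, $g_i=\sum g_{i,\alpha}x^\alpha$; $d=\lceil\deg(f)/2\rceil$, $d_i=\lceil\deg(g_i)/2\rceil$; $\|p\|_{\ell_1}$ is the sum of absolute values of the coefficients of $p$; $v_t=(x^\alpha)_{\alpha\in\mathbb N^n_t}$; $\mathbb S^N$, $\mathbb S^N_+$: real symmetric, resp. positive semidefinite, $N\times N$ matrices. For $y=(y_\alpha)_{\alpha\in\mathbb N^n_{2k}}$: $M_k(y)=(y_{\alpha+\beta})_{\alpha,\beta\in\mathbb N^n_k}$; $M_{k-d_i}(g_iy)=(\sum_\gamma g_{i,\gamma}y_{\alpha+\beta+\gamma})_{\alpha,\beta\in\mathbb N^n_{k-d_i}}$; $L_y(\sum p_\alpha x^\alpha)=\sum p_\alpha y_\alpha$; $D_k(gy)=\operatorname{diag}((M_{k-d_i}(g_iy))_{i=0,\dots,m})$. For a measure $\mu$ with finite moments, $D_k(g\mu)=D_k(gy)$ with $y_\alpha=\int x^\alpha d\mu$. $\lambda_{\min}(\cdot)$ of a matrix is its smallest eigenvalue (implicitly positive in (a)). Relaxations. SOS: $\lambda_k=\sup\{\lambda:\ \lambda\in\mathbb R,\ G=\operatorname{diag}(G_0,\dots,G_m)\succeq0,\ f-\lambda=\sum_{i=0}^mg_iv_{k-d_i}^\top G_iv_{k-d_i}\}$. Moment: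 $\tau_k=\min\{L_y(f): y=(y_\alpha)_{\alpha\in\mathbb N^n_{2k}},\ y_0=1,\ M_k(y)\succeq0,\ M_{k-d_i}(g_iy)\succeq0,\ i=1,\dots,m\}$. Strong duality means $\lambda_k=\tau_k$ and both problems have optimal solutions. Hamiltonian updates HU. Input: $\varepsilon>0$, $A'_1,\dots,A'_{M'}\in\mathbb S^N$, $b'_1,\dots,b'_{M'}\in\mathbb R$ (encoding: find $X\succeq0$ with $\operatorname{tr}X=1$, $\operatorname{tr}(A'_jX)\le b'_j$ for all $j$). Set $W^{(1)}=I_N$ and $T'=\lceil 16\log(N)/\varepsilon^2\rceil$. For $t=1,\dots,T'$: set $P^{(t)}=W^{(t)}/\operatorname{tr}(W^{(t)})$; if some $j^{(t)}$ satisfies $\operatorname{tr}(A'_{j^{(t)}}P^{(t)})>b'_{j^{(t)}}+\varepsilon$, choose one and set $M^{(t)}=\frac12(I_N-A'_{j^{(t)}})$; otherwise stop with output $\eta=1$. Set $W^{(t+1)}=\exp\big(\frac{\varepsilon}{4}\sum_{s=1}^tM^{(s)}\big)$. If the loop completes, output $\eta=0$. Binary search BS. Input: $C,A_1,\dots,A_M\in\mathbb S^N$, $b\in\mathbb R^M$, reals $\lambda_{\min}<\lambda_{\max}$, $\varepsilon>0$. Set $\underline\lambda_0=\lambda_{\min}$, $\overline\lambda_0=\lambda_{\max}$, $T=\lceil\log_2((\lambda_{\max}-\lambda_{\min})/\varepsilon)\rceil$ (no iterations if $T\le 0$). For $t=0,\dots,T-1$: let $\lambda_t=(\underline\lambda_t+\overline\lambda_t)/2$;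 run HU with accuracy $\varepsilon$ on the constraints $\operatorname{tr}(A_iX)\le b_i$, $\operatorname{tr}(-A_iX)\le -b_i$ ($i=1,\dots,M$), $\operatorname{tr}(CX)\le\lambda_t$; if $\eta=0$ set $(\underline\lambda_{t+1},\overline\lambda_{t+1})=(\lambda_t,\overline\lambda_t)$, if $\eta=1$ set $(\underline\lambda_{t+1},\overline\lambda_{t+1})=(\underline\lambda_t,\lambda_t)$. Output: the final lower value $\underline\lambda_T$. Algorithm CON. For $i=0,\dots,m$ and $\eta\in\mathbb N^n$, let $B_i^{(\eta)}$ be the matrix indexed by $\mathbb N^n_{k-d_i}$ with $(\alpha,\beta)$-entry $1$ if $\alpha+\beta=\eta$ and $0$ otherwise. For $\gamma\in\mathbb N^n_{2k}$ put $B_g^{(\gamma)}=\operatorname{diag}\big(\big(\sum_{\zeta\in\mathbb N^n_{2d_i},\,\gamma-\zeta\in\mathbb N^n}g_{i,\zeta}B_i^{(\gamma-\zeta)}\big)_{i=0,\dots,m}\big)$. Enumerate $\mathbb N^n_{2k}=\{\gamma_0=0,\gamma_1,\dots,\gamma_M\}$, $M=\binom{n+2k}{n}-1$. Put $C=\operatorname{diag}(B_g^{(0)},0)$, $A_i=\operatorname{diag}(B_g^{(\gamma_i)},0)$, $b_i=f_{\gamma_i}$ ($i=1,\dots,M$), of size $N=1+\sum_{i=0}^m\binom{n+k-d_i}{n}$; $\lambda_{\min}=f_0-f(a)$, $\lambda_{\max}=f_0-\underline\lambda$ (with $\lambda_{\min}<\lambda_{\max}$ as required by BS). Run BS and return $\lambda_k^{(\varepsilon)}=f_0-\underline\lambda_T$.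 *)

(* Defs.v *)
From HB Require Import structures.
From mathcomp Require Import all_boot all_order all_algebra.
(* The notations of mpoly clash with those of MathComp-Analysis. *)
From mathcomp Require Import -(notations) mpoly.
From mathcomp Require Import all_classical all_reals all_analysis.

Set Implicit Arguments.
Unset Strict Implicit.
Unset Printing Implicit Defensive.

Import Order.TTheory GRing.Theory Num.Theory.
Import numFieldNormedType.Exports.

Local Open Scope classical_set_scope.
Local Open Scope ring_scope.

Section Polynomials.
Variables (R : realType) (n : nat).
Implicit Types p : mpoly n R.

(* The zero polynomial gets degree 0. *)
Definition mdegree p : nat := (mmeasure (@mdeg n) p).-1.

Definition half_degree p : nat := uphalf (mdegree p).

Definition coef_l1norm p : R := \sum_(a <- msupp p) `|mcoeff a p|.

Definition point_l1norm (x : n.-tuple R) : R := \sum_(i < n) `|tnth x i|.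

Definition peval p (x : n.-tuple R) : R := meval (tnth x) p.

End Polynomials.

(* [bmultinom n t.+1] is the set of multi-indices of total degree <= t; [mnum]
   is its cardinality, and [mnth] the enumeration that indexes the rows and
   columns of the matrices below. *)
Definition mnum (n t : nat) : nat := #|{: bmultinom n t.+1}|.

Definition mnth (n t : nat) (i : 'I_(mnum n t)) : multinom n :=
  bmnm (enum_val i).

Section Matrices.
Variables (R : realType) (N : nat).
Implicit Types A : 'M[R]_N.

Definition psd A : Prop :=
  A^T = A /\ forall u : 'rV[R]_N, 0 <= (u *m A *m u^T) 0 0.

Definition lambda_min A : R := inf [set l : R | eigenvalue A l].

Definition expmx A : 'M[R]_N :=
  limn (series (fun j => (j`!%:R : R)^-1 *: A ^+ j)).

End Matrices.

Section Relaxations.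
Variables (R : realType) (n m : nat).
Variables (f : mpoly n R) (g : 'I_m.+1 -> mpoly n R) (k : nat).

Definition feasible_set : set (n.-tuple R) :=
  [set x | forall i, i != ord0 -> 0 <= peval (g i) x].

Definition fstar : \bar R := ereal_inf [set (peval f x)%:E | x in feasible_set].

Definition block_degree (i : 'I_m.+1) : nat := (k - half_degree (g i))%N.

Definition block_size (i : 'I_m.+1) : nat := mnum n (block_degree i).

Definition mon_vec (t : nat) : 'cV[mpoly n R]_(mnum n t) :=
  \col_i mpolyX R (mnth i).

Definition sos_feasible (lam : R)
    (G : forall i : 'I_m.+1, 'M[R]_(block_size i)) : Prop :=
  psd (\mxdiag_i G i) /\
  f - mpolyC n lam =
    \sum_i g i * (((mon_vec (block_degree i))^T *m map_mx (@mpolyC n R) (G i)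
                   *m mon_vec (block_degree i)) 0 0).

Definition sos_value : \bar R :=
  ereal_sup [set lam%:E | lam in [set lam | exists G, sos_feasible lam G]].

Definition pseudo_moments := bmultinom n (2 * k).+1 -> R.

(* y_a; the junk value 0 for |a| > 2k is never used when all the half-degrees
   of f and g are at most k. *)
Definition pm_at (y : pseudo_moments) (a : multinom n) : R :=
  oapp y 0 (insub a).

Definition riesz (y : pseudo_moments) (p : mpoly n R) : R :=
  \sum_(a <- msupp p) mcoeff a p * pm_at y a.

Definition moment_mx (y : pseudo_moments) : 'M[R]_(mnum n k) :=
  \matrix_(i, j) pm_at y (mnm_add (mnth i) (mnth j)).

Definition localizing_mx (y : pseudo_moments) (i : 'I_m.+1) :
    'M[R]_(block_size i) :=
  \matrix_(r, s) \sum_(c <- msupp (g i))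
    mcoeff c (g i) * pm_at y (mnm_add (mnm_add (mnth r) (mnth s)) c).

Definition Dmx (y : pseudo_moments) : 'M[R]_(\sum_i block_size i) :=
  \mxdiag_i localizing_mx y i.

Definition moment_feasible (y : pseudo_moments) : Prop :=
  [/\ y bm0 = 1, psd (moment_mx y) &
      forall i, i != ord0 -> psd (localizing_mx y i)].

Definition moment_value : \bar R :=
  ereal_inf [set (riesz y f)%:E | y in moment_feasible].

Definition strong_duality : Prop :=
  [/\ sos_value = moment_value,
      exists lam, exists G, sos_feasible lam G /\ lam%:E = sos_value &
      exists y, moment_feasible y /\ (riesz y f)%:E = moment_value].

End Relaxations.

Section MeasureMoments.
Variables (R : realType) (n : nat).
(* The product sigma-algebra on n-tuples is the Borel sigma-algebra of R^n. *)
Variable mu : {measure set (n.-tuple R) -> \bar R}.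

Definition monomial_fun (a : multinom n) (x : n.-tuple R) : R :=
  peval (mpolyX R a) x.

Definition finite_moments (t : nat) : Prop :=
  forall a : bmultinom n t.+1,
    mu.-integrable setT (fun x => (monomial_fun a x)%:E).

Definition moments (k : nat) : pseudo_moments R n k :=
  fun a => Rintegral mu setT (monomial_fun a).

End MeasureMoments.

Arguments moments {R n} mu k a.

Section HamiltonianUpdates.
Variables (R : realType) (N : nat) (J : finType).
Variables (eps : R) (A : J -> 'M[R]_N) (b : J -> R).

Definition ceil_nat (x : R) : nat := absz (Num.max 0 (Num.ceil x)).

Definition hu_steps : nat := ceil_nat (16 * ln (N%:R : R) / eps ^+ 2).

(* A state of the loop is the list js of the constraints chosen so far, oldest
   first: before step t, js has size t - 1. *)
Definition hu_W (js : seq J) : 'M[R]_N :=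
  if js is [::] then 1%:M
  else expmx ((eps / 4) *: \sum_(j <- js) ((1 / 2) *: (1%:M - A j))).

Definition hu_P (js : seq J) : 'M[R]_N := (\tr (hu_W js))^-1 *: hu_W js.

Definition hu_violated (js : seq J) (j : J) : Prop :=
  b j + eps < \tr (A j *m hu_P js).

Inductive hu_state : seq J -> Prop :=
| HuStart : hu_state [::]
| HuStep js j : hu_state js -> (size js < hu_steps)%N -> hu_violated js j ->
    hu_state (rcons js j).

(* The choice of the violated constraint is free, so the output is a relation;
   [true] stands for eta = 1 and [false] for eta = 0. *)
Inductive hu_output : bool -> Prop :=
| HuStop js : hu_state js -> (size js < hu_steps)%N ->
    (forall j, ~ hu_violated js j) -> hu_output true
| HuComplete js : hu_state js -> size js = hu_steps -> hu_output false.

Lemma hu_output_exists : exists eta, hu_output eta.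
Proof.
have H d js : hu_state js -> (size js + d = hu_steps)%N ->
    exists eta, hu_output eta.
  elim: d js => [|d IH] js hjs.
    by rewrite addn0 => e; exists false; exact: HuComplete hjs e.
  move=> e; have lt_js : (size js < hu_steps)%N.
    by rewrite -e -addSnnS leq_addr.
  have [[j vj]|nv] := pselect (exists j, hu_violated js j).
    by apply: (IH (rcons js j)); [exact: HuStep|rewrite size_rcons addSnnS].
  by exists true; apply: (HuStop hjs lt_js) => j vj; apply: nv; exists j.
exact: (H hu_steps [::] HuStart).
Qed.

End HamiltonianUpdates.

Section BinarySearch.
Variables (R : realType) (N : nat) (I : finType).
Variables (C : 'M[R]_N) (A : I -> 'M[R]_N) (b : I -> R) (lmin lmax eps : R).

Definition bs_mx (j : I + I + unit) : 'M[R]_N :=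
  match j with
  | inl (inl i) => A i
  | inl (inr i) => - A i
  | inr tt => C
  end.

Definition bs_rhs (lam : R) (j : I + I + unit) : R :=
  match j with
  | inl (inl i) => b i
  | inl (inr i) => - b i
  | inr tt => lam
  end.

Definition bs_steps : nat := ceil_nat (ln ((lmax - lmin) / eps) / ln 2).

Inductive bs_state : nat -> R -> R -> Prop :=
| BsStart : bs_state 0 lmin lmax
| BsInfeasible t lo hi : bs_state t lo hi -> (t < bs_steps)%N ->
    hu_output eps bs_mx (bs_rhs ((lo + hi) / 2)) false ->
    bs_state t.+1 ((lo + hi) / 2) hi
| BsFeasible t lo hi : bs_state t lo hi -> (t < bs_steps)%N ->
    hu_output eps bs_mx (bs_rhs ((lo + hi) / 2)) true ->
    bs_state t.+1 lo ((lo + hi) / 2).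

Definition bs_output (l : R) : Prop := exists hi, bs_state bs_steps l hi.

Lemma bs_output_exists : exists l, bs_output l.
Proof.
have H t : (t <= bs_steps)%N -> exists lo, exists hi, bs_state t lo hi.
  elim: t => [_|t IH tT]; first by exists lmin, lmax; exact: BsStart.
  have [lo [hi st]] := IH (ltnW tT).
  have [[] e] := hu_output_exists eps bs_mx (bs_rhs ((lo + hi) / 2)).
    by exists lo, ((lo + hi) / 2); exact: BsFeasible.
  by exists ((lo + hi) / 2), hi; exact: BsInfeasible.
have [lo [hi st]] := H _ (leqnn _).
by exists lo, hi.
Qed.

End BinarySearch.

Section AlgorithmCON.
Variables (R : realType) (n m : nat).
Variables (f : mpoly n R) (g : 'I_m.+1 -> mpoly n R) (k : nat).

Definition Bmx (i : 'I_m.+1) (e : multinom n) : 'M[R]_(block_size g k i) :=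
  \matrix_(r, s) (mnm_add (mnth r) (mnth s) == e)%:R.

(* [mpoly.lem] is the componentwise order on multi-indices. *)
Definition Bgmx (c : multinom n) : 'M[R]_(\sum_i block_size g k i) :=
  \mxdiag_i \sum_(z : bmultinom n (2 * half_degree (g i)).+1 | mpoly.lem z c)
    mcoeff z (g i) *: Bmx i (mnm_sub c z).

Definition con_mx (c : multinom n) : 'M[R]_(\sum_i block_size g k i + 1) :=
  block_mx (Bgmx c) 0 0 0.

Definition nonzero_index : finType :=
  {c : bmultinom n (2 * k).+1 | c != bm0}.

Definition con_output (eps lamlow : R) (a : n.-tuple R) (v : R) : Prop :=
  let f0 := mcoeff mnm0 f in
  exists2 l : R,
    bs_output (con_mx mnm0)
      (fun c : nonzero_index => con_mx (val c))
      (fun c : nonzero_index => mcoeff (val c) f)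
      (f0 - peval f a) (f0 - lamlow) eps l
    & v = f0 - l.

End AlgorithmCON.

(* Main.v *)
(** Comparing coefficients turns the sum-of-squares relaxation into the semidefinite
    program of minimizing [tr (C X)] under [tr (A_c X) = f_c], with value
    [v = f_0 - lambda_k]; integrating an optimal certificate against [mu] gives
    [lambda_min (D) tr G <= \int (f - lambda_k) dmu], so that [tr G <= 1] and a
    slack entry makes [G] a density matrix. Since [||g_i||_1 <= 1], all constraint
    matrices have absolute row sums at most [1], and the matrix multiplicative
    weights argument shows that Hamiltonian updates never declare a feasible
    problem infeasible: with [eta = eps / 4], [tr W] is bounded above by
    Golden-Thompson, and below by [exp (tr (S X))] for every feasible [X].
    Conversely, when Hamiltonian updates stop early, pairing the approximate
    solution with the moments of the Dirac measure at [xstar] shows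
    [v <= lambda_t + eps (1 + sum_{c <> 0} |xstar^c|)], and the sum is at most
    [r / (1 - r)]. Bisection then loses at most one more [eps].

    Golden-Thompson is obtained without spectral theory, from
    [tr (A B)^n <= tr (A^n B^n)] for symmetric [A], [B] and [n] a power of two, and
    from [(1 + S / n)^n --> exp S]. *)
Require Import Defs.
From HB Require Import structures.
From mathcomp Require Import all_boot all_order all_algebra.
From mathcomp Require Import -(notations) mpoly.
From mathcomp Require ssrcomplements.
From mathcomp Require Import all_classical all_reals all_analysis.
From mathcomp Require Import ring lra.

Set Implicit Arguments.
Unset Strict Implicit.
Unset Printing Implicit Defensive.

Import Order.TTheory GRing.Theory Num.Theory.
Import numFieldNormedType.Exports.

Local Open Scope classical_set_scope.
Local Open Scope ring_scope.

(** * Trace inequalities for products and powers of symmetric matrices *)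

Section TraceInequalities.
Variables (R : realType) (N : nat).
Implicit Types (A B K M P Q X : 'M[R]_N) (u v : 'rV[R]_N).

Lemma quad_formE A u :
  (u *m A *m u^T) 0 0 = \sum_i \sum_j u 0 i * A i j * u 0 j.
Proof.
rewrite mxE exchange_big; apply: eq_bigr => j _ /=.
by rewrite !mxE mulr_suml.
Qed.

Lemma mxtrace_conj A K :
  \tr (K *m A *m K^T) = \sum_i (row i K *m A *m (row i K)^T) 0 0.
Proof.
apply: eq_bigr => i _; rewrite -row_mul !mxE.
by apply: eq_bigr => j _; rewrite !mxE.
Qed.

Lemma mxtrace_mul_tr A : \tr (A *m A^T) = \sum_i \sum_j A i j ^+ 2.
Proof.
by apply: eq_bigr => i _; rewrite mxE; apply: eq_bigr => j _; rewrite mxE expr2.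
Qed.

Lemma psd_conj p A (K : 'M[R]_(p, N)) : psd A -> psd (K *m A *m K^T).
Proof.
move=> [sA pA]; split; first by rewrite !trmx_mul trmxK sA mulmxA.
by move=> u; have := pA (u *m K); rewrite trmx_mul !mulmxA.
Qed.

Lemma psd_mxtrace_conj A K : psd A -> 0 <= \tr (K *m A *m K^T).
Proof. by move=> [_ pA]; rewrite mxtrace_conj; apply: sumr_ge0 => i _. Qed.

Lemma psd_scalar1 : psd (1%:M : 'M[R]_N).
Proof.
split; first exact: trmx1.
by move=> u; rewrite mulmx1 mxE; apply: sumr_ge0 => i _; rewrite mxE -expr2 sqr_ge0.
Qed.

Lemma psd_add A B : psd A -> psd B -> psd (A + B).
Proof.
move=> [sA pA] [sB pB]; split; first by rewrite linearD /= sA sB.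
by move=> u; rewrite mulmxDr mulmxDl mxE addr_ge0.
Qed.

Lemma psd_scale (c : R) A : 0 <= c -> psd A -> psd (c *: A).
Proof.
move=> c0 [sA pA]; split; first by rewrite linearZ /= sA.
by move=> u; rewrite -scalemxAr -scalemxAl mxE mulr_ge0.
Qed.

Lemma trmx_exp A j : A^T = A -> (A ^+ j)^T = A ^+ j.
Proof.
move=> sA; elim: j => [|j IH]; first by rewrite expr0 trmx1.
by rewrite exprS -mulmxE trmx_mul IH sA mulmxE -exprSr exprS.
Qed.

(** Expand the squared Frobenius norm of [P - Q^T]. *)
Lemma mxtrace_mul_le P Q :
  2 * \tr (P *m Q) <= \tr (P *m P^T) + \tr (Q *m Q^T).
Proof.
have : 0 <= \tr ((P - Q^T) *m (P - Q^T)^T).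
  rewrite mxtrace_mul_tr; apply: sumr_ge0 => i _; apply: sumr_ge0 => j _.
  exact: sqr_ge0.
rewrite linearB /= trmxK mulmxBl !mulmxBr !raddfB /=.
rewrite (mxtrace_mulC Q^T Q) -[\tr (Q^T *m P^T)]mxtrace_tr trmx_mul !trmxK.
lra.
Qed.

Lemma mulmx_expS A B j : (A *m B) ^+ j.+1 = A *m (B *m A) ^+ j *m B.
Proof.
elim: j => [|j IH]; first by rewrite expr1 expr0 mulmx1.
by rewrite exprS IH [in RHS]exprS -!mulmxE !mulmxA.
Qed.

Lemma mxtrace_mulC_exp A B j : \tr ((A *m B) ^+ j) = \tr ((B *m A) ^+ j).
Proof.
case: j => [//|j]; rewrite mulmx_expS -mulmxA mxtrace_mulC.
by rewrite -mulmxA mulmxE -exprSr.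
Qed.

(* The two inequalities are proved together: applied to [X^2], the second one
   yields the product of [X^T X] and [X X^T], to which the first one applies. *)
Lemma golden_thompson_pow2 k :
  (forall A B, A^T = A -> B^T = B ->
     \tr ((A *m B) ^+ (2 ^ k)) <= \tr (A ^+ (2 ^ k) *m B ^+ (2 ^ k))) /\
  (forall X, \tr (X ^+ (2 ^ k.+1)) <= \tr ((X *m X^T) ^+ (2 ^ k))).
Proof.
have sq_le X : \tr (X ^+ 2) <= \tr (X *m X^T).
  have := mxtrace_mul_le X X; rewrite -mulr2n -[X in _ <= X]mulr_natl.
  by rewrite ler_pM2l ?ltr0n // mulmxE -expr2.
elim: k => [|k [IHG IHH]].
  by split=> [A B _ _|X]; rewrite ?expn0 ?expn1 ?expr1.
split=> [A B sA sB|X].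
  (* With [X = A B], the second inequality produces powers of [A B B A], which have the same trace
     as those of [A^2 B^2]; the first inequality then applies to [A^2] and [B^2]. *)
  apply: (le_trans (IHH _)); rewrite trmx_mul sA sB.
  rewrite -mulmxA mxtrace_mulC_exp !mulmxA -!(mulmxA _ A A).
  have -> : B *m B *m (A *m A) = (B ^+ 2) *m (A ^+ 2).
    by rewrite !mulmxE -!expr2.
  rewrite mxtrace_mulC_exp.
  apply: (le_trans (IHG _ _ _ _)); rewrite ?trmx_exp //.
  by rewrite -!exprM -expnS.
rewrite expnS exprM; apply: (le_trans (IHH _)).
rewrite expr2 -mulmxE trmx_mul -mulmxA mxtrace_mulC_exp.
have -> : X *m (X^T *m X^T) *m X = (X *m X^T) *m (X^T *m X).
  by rewrite !mulmxA.
have sL : (X *m X^T)^T = X *m X^T by rewrite trmx_mul trmxK.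
have sR : (X^T *m X)^T = X^T *m X by rewrite trmx_mul trmxK.
apply: (le_trans (IHG _ _ sL sR)).
(* Equal powers of [X X^T] and [X^T X] have equal traces, so the two squares bounding twice the
   trace of the product merge into one term. *)
rewrite -(ler_pM2l (ltr0n R 2)).
apply: (le_trans (mxtrace_mul_le _ _)).
rewrite !trmx_exp // !mulmxE -!exprD addnn -mul2n -expnS.
by rewrite -!mulmxE (mxtrace_mulC_exp X^T) mulr_natl mulr2n.
Qed.

Lemma psd_exp_even A j : A^T = A -> psd (A ^+ (2 * j)).
Proof.
move=> sA; have := psd_conj (A ^+ j) psd_scalar1.
by rewrite mulmx1 trmx_exp // mulmxE -exprD addnn -mul2n.
Qed.

(** All factors commute. For even [j] this is [1 - M] conjugated by [M^(j/2)]. For odd [j] it is a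
    conjugate of [M (1 - M) = M (1 - M) M + (1 - M) M (1 - M)]. No square root of [M] is taken. *)
Lemma mulmx_psd1_exp M j : psd M -> psd (1%:M - M) -> psd (M ^+ j *m (1%:M - M)).
Proof.
move=> pM p1M; have sM := pM.1.
have ceq i Q : M ^+ i *m Q *m (M ^+ i)^T = M ^+ i *m Q *m M ^+ i.
  by rewrite trmx_exp.
have cM i : M ^+ i *m (1%:M - M) = (1%:M - M) *m M ^+ i.
  by rewrite mulmxBr mulmxBl mulmx1 mul1mx !mulmxE -exprSr -exprS.
rewrite -(odd_double_half j) -addnn addnC.
case: (odd j) => /=.
  have -> : M ^+ (j./2 + j./2 + true) *m (1%:M - M) =
      M ^+ j./2 *m (M *m (1%:M - M)) *m (M ^+ j./2)^T.
    have cP : M ^+ j./2 *m M = M *m M ^+ j./2 by rewrite !mulmxE -exprSr -exprS.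
    rewrite ceq addn1 exprSr exprD -!mulmxE -!mulmxA -cM (mulmxA M).
    by rewrite -cP !mulmxA.
  apply: psd_conj.
  have -> : M *m (1%:M - M) =
      M *m (1%:M - M) *m M^T + (1%:M - M) *m M *m (1%:M - M)^T.
    rewrite sM p1M.1 -[in X in _ = _ + X](cM 1%N) expr1 -mulmxDr.
    by rewrite subrKC mulmx1.
  by apply: psd_add; apply: psd_conj.
rewrite addn0.
have -> : M ^+ (j./2 + j./2) *m (1%:M - M) =
    M ^+ j./2 *m (1%:M - M) *m (M ^+ j./2)^T.
  by rewrite ceq exprD -mulmxE -!mulmxA cM.
exact: psd_conj.
Qed.

End TraceInequalities.

(** * Bounds on the trace of [(1 + S / n)^n] for [n] a power of two *)

Section FiniteTraceBounds.
Variables (R : realType) (N : nat).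
Implicit Types (A B K L M P Q S X : 'M[R]_N).

Lemma mx_expZ (c : R) A j : (c *: A) ^+ j = c ^+ j *: A ^+ j.
Proof.
elim: j => [|j IH]; first by rewrite !expr0 scale1r.
by rewrite !exprS IH -!mulmxE -scalemxAl -scalemxAr scalerA.
Qed.

Lemma mxtrace_mul_tr_psd_ge0 L P : psd P -> 0 <= \tr (L *m L^T *m P).
Proof.
move=> pP; rewrite -mulmxA mxtrace_mulC.
by have := psd_mxtrace_conj L^T pP; rewrite trmxK.
Qed.

Lemma exp_even_mul_tr A j : A^T = A -> A ^+ (2 * j) = A ^+ j *m (A ^+ j)^T.
Proof. by move=> sA; rewrite trmx_exp // mulmxE -exprD addnn mul2n. Qed.

(** Consecutive powers differ by [M^j (1 - M)], which is positive semidefinite, and a weight of the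
    form [L L^T] pairs nonnegatively with it. *)
Lemma mxtrace_mul_exp_le L M j : psd M -> psd (1%:M - M) ->
  \tr (L *m L^T *m M ^+ j.+1) <= \tr (L *m L^T *m M).
Proof.
move=> pM p1M; elim: j => [|j IH]; first by rewrite expr1.
apply: le_trans IH.
have := mxtrace_mul_tr_psd_ge0 L (mulmx_psd1_exp j.+1 pM p1M).
by rewrite mulmxBr mulmx1 mulmxBr raddfB /= subr_ge0 !mulmxE -!exprSr.
Qed.

(** Matrix form of the chord bound [(1 + h x)^n <= 1 + ((1 + h)^n - 1) x] on [[0, 1]]: in the
    binomial expansion every power of [M] of positive exponent is replaced by [M]. *)
Lemma mxtrace_mul_exp1D_le L M (h : R) n : psd M -> psd (1%:M - M) -> 0 <= h ->
  \tr (L *m L^T *m (1%:M + h *: M) ^+ n) <=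
  \tr (L *m L^T) + ((1 + h) ^+ n - 1) * \tr (L *m L^T *m M).
Proof.
move=> pM p1M h0; set K := L *m L^T.
have -> : (1%:M + h *: M) ^+ n =
    \sum_(i < n.+1) ('C(n, i)%:R * h ^+ i) *: M ^+ i.
  rewrite addrC exprD1n; apply: eq_bigr => i _.
  by rewrite mx_expZ -scaler_nat scalerA.
have -> : (1 + h) ^+ n = \sum_(i < n.+1) 'C(n, i)%:R * h ^+ i.
  by rewrite addrC exprD1n; apply: eq_bigr => i _; rewrite mulr_natl.
rewrite !big_ord_recl /= bin0 !expr0 mulr1 scale1r addrAC subrr add0r.
rewrite mulmxDr mulmx1 raddfD /= lerD2l mulmx_sumr raddf_sum /= mulr_suml.
apply: ler_sum => i _; rewrite -scalemxAr mxtraceZ.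
apply: ler_wpM2l; first by rewrite mulr_ge0 ?exprn_ge0 ?ler0n.
exact: mxtrace_mul_exp_le.
Qed.

Lemma exp1D_div_le_expR (x : R) n : (0 < n)%N -> 0 <= x ->
  (1 + n%:R^-1 * x) ^+ n <= expR x.
Proof.
move=> n0 x0; have nz : n%:R != 0 :> R by rewrite pnatr_eq0 -lt0n.
have -> : expR x = expR (n%:R^-1 * x) ^+ n.
  by rewrite -expRM_natl mulrA divff // mul1r.
apply: lerXn2r; rewrite ?nnegrE ?expR_ge0 ?expR_ge1Dx //.
by rewrite addr_ge0 // mulr_ge0 // invr_ge0 ler0n.
Qed.

(** One step of multiplicative weights before the limit. The exponent is even so that
    [(1 + S / n)^n] has the form [L L^T] demanded by the chord bound. *)
Lemma mxtrace_exp_prod_le S M (eta : R) k (n := (2 ^ k.+1)%N) :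
  S^T = S -> psd M -> psd (1%:M - M) -> 0 <= eta ->
  \tr (((1%:M + n%:R^-1 *: S) *m (1%:M + n%:R^-1 *: (eta *: M))) ^+ n) <=
  \tr ((1%:M + n%:R^-1 *: S) ^+ n) +
    (expR eta - 1) * \tr (M *m (1%:M + n%:R^-1 *: S) ^+ n).
Proof.
move=> sS pM p1M eta0.
set A := 1%:M + _ *: S; set B := 1%:M + _ *: (_ *: M).
have sA : A^T = A by rewrite linearD linearZ /= trmx1 sS.
have sB : B^T = B by rewrite linearD !linearZ /= trmx1 pM.1.
apply: (le_trans ((golden_thompson_pow2 R N k.+1).1 _ _ sA sB)).
rewrite -/n (_ : n = 2 * 2 ^ k)%N ?/n ?expnS // exp_even_mul_tr //.
rewrite -expnS -/n /B scalerA.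
apply: (le_trans (mxtrace_mul_exp1D_le _ _ pM p1M _)).
  by rewrite mulr_ge0 ?invr_ge0 ?ler0n.
rewrite lerD2l [\tr (M *m _)]mxtrace_mulC; apply: ler_wpM2r.
  exact: mxtrace_mul_tr_psd_ge0.
by rewrite lerD2r exp1D_div_le_expR // expn_gt0.
Qed.

(** Test [X] on the vectors [u_j e_i - u_i e_j] and sum over all [i] and [j]. *)
Lemma psd_le_mxtrace X (u : 'rV[R]_N) : psd X ->
  (u *m X *m u^T) 0 0 <= \tr X * \sum_i u 0 i ^+ 2.
Proof.
move=> [sX pX]; rewrite quad_formE.
have key i j : 2 * (u 0 i * X i j * u 0 j) <=
    u 0 j ^+ 2 * X i i + u 0 i ^+ 2 * X j j.
  have := pX (u 0 j *: delta_mx 0 i - u 0 i *: delta_mx 0 j).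
  rewrite mulmxBl -!scalemxAl -!rowE [(_ - _)^T]linearB !linearZ /= !trmx_delta.
  rewrite mulmxDr !mulmxDl -!scalemxAr -!scalemxAl !mulmxN !mulNmx -!colE !mxE.
  have -> : X j i = X i j by rewrite -[in LHS]sX mxE.
  nra.
have sumE : \sum_i \sum_j (u 0 j ^+ 2 * X i i + u 0 i ^+ 2 * X j j) =
    2 * (\tr X * \sum_i u 0 i ^+ 2).
  under eq_bigr do rewrite big_split /= -mulr_suml -mulr_sumr.
  by rewrite big_split /= -mulr_sumr -mulr_suml -/(mxtrace X); ring.
rewrite -(ler_pM2l (ltr0Sn R 1)) -sumE mulr_sumr.
apply: ler_sum => i _; rewrite mulr_sumr; apply: ler_sum => j _.
exact: key.
Qed.

Lemma mxtrace_exp_even_mul_le K X j : K^T = K -> psd X -> \tr X = 1 ->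
  \tr (K ^+ (2 * j) *m X) <= \tr (K ^+ (2 * j)).
Proof.
move=> sK pX tX; rewrite exp_even_mul_tr // mxtrace_mul_tr.
have -> : \tr (K ^+ j *m (K ^+ j)^T *m X) = \tr (K ^+ j *m X *m (K ^+ j)^T).
  by rewrite trmx_exp // -mulmxA mxtrace_mulC.
rewrite mxtrace_conj.
apply: ler_sum => i _; apply: (le_trans (psd_le_mxtrace _ pX)).
by rewrite tX mul1r; under eq_bigr do rewrite mxE.
Qed.

(** Jensen's inequality in the state [X]: the variance of [K] is nonnegative, which is the case of
    squares, and squaring is iterated. *)
Lemma mxtrace_mul_exp_pow2 K X k : K^T = K -> psd X -> \tr X = 1 ->
  \tr (K *m X) ^+ (2 ^ k) <= \tr (K ^+ (2 ^ k) *m X).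
Proof.
move=> sK pX tX; elim: k K sK => [|k IH] K sK; first by rewrite expn0 !expr1.
have cs : \tr (K *m X) ^+ 2 <= \tr (K ^+ 2 *m X).
  set c := \tr (K *m X).
  have s' : (K - c%:M)^T = K - c%:M by rewrite linearB /= tr_scalar_mx sK.
  have := psd_mxtrace_conj (K - c%:M) pX; rewrite s' mxtrace_mulC mulmxA.
  rewrite mulmxBl !mulmxBr !mulmxBl !raddfB /= mul_scalar_mx mul_mx_scalar.
  rewrite -scalar_mxM mul_scalar_mx -!scalemxAl !mxtraceZ -/c tX mulmxE -expr2.
  lra.
case: k IH => [|k] IH; first by rewrite expn1.
rewrite expnS !exprM; apply: le_trans (IH (K ^+ 2) _); last exact: trmx_exp.
apply: lerXn2r => //; rewrite nnegrE ?sqr_ge0 //.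
exact: le_trans (sqr_ge0 _) cs.
Qed.

Lemma exp1D_mxtrace_le S X k (n := (2 ^ k.+1)%N) :
  S^T = S -> psd X -> \tr X = 1 ->
  (1 + n%:R^-1 * \tr (S *m X)) ^+ n <= \tr ((1%:M + n%:R^-1 *: S) ^+ n).
Proof.
move=> sS pX tX; set A := 1%:M + _.
have sA : A^T = A by rewrite linearD linearZ /= trmx1 sS.
have -> : 1 + n%:R^-1 * \tr (S *m X) = \tr (A *m X).
  by rewrite mulmxDl mul1mx mxtraceD tX -scalemxAl mxtraceZ.
apply: (le_trans (mxtrace_mul_exp_pow2 _ sA pX tX)).
by rewrite /n expnS; apply: mxtrace_exp_even_mul_le.
Qed.

End FiniteTraceBounds.

(** * The matrix exponential as a limit of powers, controlled by row sums *)

Section MatrixExponentialLimit.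
Variable R : realType.

(** With [y = x / n], [e^y (1 - y) <= 1] gives [e^x (1 - y^2)^n <= (1 + y)^n], and Bernoulli's
    inequality bounds [(1 - y^2)^n] below by [1 - n y^2]. *)
Lemma expR_sub_exp1D_le (x : R) n : (0 < n)%N -> x ^+ 2 <= n%:R ->
    `|x| <= n%:R ->
  `|expR x - (1 + n%:R^-1 * x) ^+ n| <= n%:R^-1 * (expR x * x ^+ 2).
Proof.
move=> n0 x2n xn; have nz : n%:R != 0 :> R by rewrite pnatr_eq0 -lt0n.
have n_gt0 : 0 < n%:R :> R by rewrite ltr0n.
set y := n%:R^-1 * x.
have xE : x = y *+ n by rewrite -mulr_natl mulrA divff // mul1r.
have y1 : `|y| <= 1.
  by rewrite normrM ger0_norm ?invr_ge0 // ler_pdivrMl // mulr1.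
have [ylo yhi] : -1 <= y /\ y <= 1 by by apply/andP; rewrite -ler_norml.
have expE : expR x = expR y ^+ n by rewrite xE -mulr_natl expRM_natl.
have le1 : (1 + y) ^+ n <= expR x.
  rewrite expE; apply: lerXn2r; rewrite ?nnegrE ?expR_ge0 ?expR_ge1Dx //; lra.
have bern : 1 - n%:R * y ^+ 2 <= (1 - y ^+ 2) ^+ n.
  elim: (n) => [|i IH]; first by rewrite mul0r subr0 expr0.
  rewrite [leRHS]exprSr; have z0 : 0 <= y ^+ 2 := sqr_ge0 y.
  have z1 : 0 <= 1 - y ^+ 2 by nra.
  have iz : 0 <= i%:R * (y ^+ 2 * y ^+ 2) by apply: mulr_ge0; [exact: ler0n|exact: mulr_ge0].
  move: (ler_wpM2r z1 IH) iz; rewrite -natr1; lra.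
have le2 : expR x * (1 - y ^+ 2) ^+ n <= (1 + y) ^+ n.
  rewrite expE -exprMn; apply: lerXn2r; rewrite ?nnegrE; [|lra|].
    by rewrite mulr_ge0 ?expR_ge0 //; nra.
  have := ler_wpM2l (expR_ge0 y) (expR_ge1Dx (- y)).
  rewrite expRN divff ?gt_eqF ?expR_gt0 // => e1.
  have : expR y * (1 + - y) * (1 + y) <= 1 * (1 + y) by apply: ler_wpM2r; lra.
  by rewrite mul1r; apply: le_trans; rewrite le_eqVlt; apply/orP; left; apply/eqP; ring.
rewrite ger0_norm ?subr_ge0 //.
have ex0 := expR_gt0 x.
have : expR x * (1 - n%:R * y ^+ 2) <= (1 + y) ^+ n.
  by apply: le_trans le2; rewrite ler_pM2l.
have -> : n%:R^-1 * (expR x * x ^+ 2) = expR x * (n%:R * y ^+ 2).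
  by rewrite /y; field.
lra.
Qed.

Variable N : nat.
Implicit Types A B S Z : 'M[R]_N.

(** A bound on the operator norm induced by the sup norm; its submultiplicativity controls matrix
    powers. *)
Definition row_sum_le A (c : R) := forall i, \sum_j `|A i j| <= c.

Lemma row_sum_le_entry A c i j : row_sum_le A c -> `|A i j| <= c.
Proof.
move=> hA; apply: le_trans (hA i); rewrite (bigD1 j) //= lerDl.
exact: sumr_ge0.
Qed.

Lemma row_sum_leD A B c e :
  row_sum_le A c -> row_sum_le B e -> row_sum_le (A + B) (c + e).
Proof.
move=> hA hB i; apply: le_trans (lerD (hA i) (hB i)); rewrite -big_split /=.
by apply: ler_sum => j _; rewrite mxE ler_normD.
Qed.

Lemma row_sum_leN A c : row_sum_le A c -> row_sum_le (- A) c.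
Proof. by move=> hA i; under eq_bigr do rewrite mxE normrN; exact: hA. Qed.

Lemma row_sum_leZ (a : R) A c :
  row_sum_le A c -> row_sum_le (a *: A) (`|a| * c).
Proof.
move=> hA i; under eq_bigr do rewrite mxE normrM.
by rewrite -mulr_sumr ler_wpM2l.
Qed.

Lemma row_sum_leM A B c e : 0 <= e ->
  row_sum_le A c -> row_sum_le B e -> row_sum_le (A *m B) (c * e).
Proof.
move=> e0 hA hB i.
apply: (@le_trans _ _ (\sum_j \sum_l `|A i l| * `|B l j|)).
  apply: ler_sum => j _; rewrite mxE; apply: le_trans (ler_norm_sum _ _ _) _.
  by apply: ler_sum => l _; rewrite normrM.
rewrite exchange_big /=; apply: (@le_trans _ _ (\sum_l `|A i l| * e)).
  by apply: ler_sum => l _; rewrite -mulr_sumr ler_wpM2l.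
by rewrite -mulr_suml ler_wpM2r.
Qed.

Lemma row_sum_le1 : row_sum_le 1%:M 1.
Proof.
move=> i; rewrite (bigD1 i) //= big1 ?addr0; first by rewrite mxE eqxx normr1.
by move=> j ji; rewrite mxE eq_sym (negbTE ji) normr0.
Qed.

Lemma row_sum_leX A c n : 0 <= c -> row_sum_le A c -> row_sum_le (A ^+ n) (c ^+ n).
Proof.
move=> c0 hA; elim: n => [|n IH]; first by rewrite !expr0; exact: row_sum_le1.
by rewrite !exprS -mulmxE; apply: row_sum_leM => //; rewrite exprn_ge0.
Qed.

Lemma row_sum_le_exists A : exists2 c, 0 <= c & row_sum_le A c.
Proof.
exists (\sum_i \sum_j `|A i j|); first by do 2!apply: sumr_ge0 => ? _.
by move=> i; rewrite [leRHS](bigD1 i) //= lerDl; do 2!apply: sumr_ge0 => ? _.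
Qed.

(** Induction on the telescoping [A^(n+2) - B^(n+2) = A^(n+1) (A - B) + (A^(n+1) - B^(n+1)) B]. *)
Lemma row_sum_le_subX A B c e n : 0 <= c -> 0 <= e ->
  row_sum_le A c -> row_sum_le B c -> row_sum_le (A - B) e ->
  row_sum_le (A ^+ n.+1 - B ^+ n.+1) (n.+1%:R * (e * c ^+ n)).
Proof.
move=> c0 e0 hA hB hAB; elim: n => [|n IH]; first by rewrite !expr1 expr0 mulr1 mul1r.
have -> : A ^+ n.+2 - B ^+ n.+2 =
    A ^+ n.+1 *m (A - B) + (A ^+ n.+1 - B ^+ n.+1) *m B.
  by rewrite mulmxBr mulmxBl !mulmxE -!exprSr addrA subrK.
have -> : n.+2%:R * (e * c ^+ n.+1) =
    c ^+ n.+1 * e + n.+1%:R * (e * c ^+ n) * c.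
  by rewrite exprS -[n.+2%:R]natr1; ring.
by apply: row_sum_leD; apply: row_sum_leM => //; exact: row_sum_leX.
Qed.

Lemma cvg_mx (F : nat -> 'M[R]_N) A :
  (forall i j, (fun n => F n i j) @ \oo --> A i j) -> F @ \oo --> A.
Proof.
move=> h; apply/cvg_mx_entourageP => E entE.
have H (ij : 'I_N * 'I_N) : \forall M \near \oo, (A ij.1 ij.2, F M ij.1 ij.2) \in E.
  have /cvg_entourageP /(_ _ entE) nearE := h ij.1 ij.2.
  apply: (@filterS _ \oo _ (fun M => E (A ij.1 ij.2, F M ij.1 ij.2))) => //.
  by move=> M; rewrite inE.
apply: (@filterS _ \oo _
    (fun M => forall ij : 'I_N * 'I_N, (A ij.1 ij.2, F M ij.1 ij.2) \in E)).
  by move=> M FM i j; exact: FM (i, j).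
exact: (@filter_forall _ _ (fun ij M => (A ij.1 ij.2, F M ij.1 ij.2) \in E) \oo).
Qed.

Definition expmx_partial_entry A i j n : R :=
  series (fun l => (l`!%:R : R)^-1 *: A ^+ l) n i j.

Lemma expmx_partial_entryE A i j n :
  expmx_partial_entry A i j n = \sum_(0 <= l < n) (l`!%:R)^-1 * (A ^+ l) i j.
Proof.
rewrite /expmx_partial_entry /series /= summxE.
by apply: eq_bigr => l _; rewrite mxE.
Qed.

(** [expmx] is a [limn], informative only once convergence is known. Each entry series is dominated
    by the scalar exponential series at a row sum bound of [A]. *)
Lemma cvg_expmx_entry A i j :
  expmx_partial_entry A i j @ \oo --> expmx A i j.
Proof.
have H i' j' : cvgn (expmx_partial_entry A i' j').
  have [c c0 hA] := row_sum_le_exists A.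
  have -> : expmx_partial_entry A i' j' =
      series (fun l => (l`!%:R)^-1 * (A ^+ l) i' j').
    by apply/funext => n; rewrite expmx_partial_entryE.
  apply: normed_cvg; apply: (series_le_cvg _ _ _ (is_cvg_series_exp_coeff c)).
  - by move=> n; exact: normr_ge0.
  - by move=> n; exact: exp_coeff_ge0.
  - move=> n; rewrite /= normrM /exp_coeff /= mulrC (@ger0_norm _ _^-1) ?invr_ge0 ?ler0n //.
    rewrite ler_wpM2r ?invr_ge0 ?ler0n //.
    exact: row_sum_le_entry (row_sum_leX n c0 hA).
pose L := \matrix_(i', j') limn (expmx_partial_entry A i' j').
suff <- : L = expmx A by rewrite mxE; exact: H.
symmetry; apply: cvg_lim; first exact: norm_hausdorff.
by apply: cvg_mx => i' j'; rewrite mxE; exact: H.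
Qed.

(** The difference is a power series in [A] with nonnegative coefficients [w l], so its entries are
    bounded by the same series at the scalar [c]. *)
Lemma expmx_sub_exp1D_le A (c : R) n i j : (0 < n)%N -> 0 <= c ->
    row_sum_le A c ->
  `|expmx A i j - ((1%:M + n%:R^-1 *: A) ^+ n) i j| <=
  expR c - (1 + n%:R^-1 * c) ^+ n.
Proof.
move=> n0 c0 hA.
pose w l : R := (l`!%:R)^-1 - 'C(n, l)%:R * n%:R^-1 ^+ l.
have binE (x : R) : (1 + n%:R^-1 * x) ^+ n =
    \sum_(0 <= l < n.+1) 'C(n, l)%:R * n%:R^-1 ^+ l * x ^+ l.
  rewrite addrC exprD1n big_mkord; apply: eq_bigr => l _.
  by rewrite exprMn -mulr_natl mulrA.
have binmxE : ((1%:M + n%:R^-1 *: A) ^+ n) i j =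
    \sum_(0 <= l < n.+1) 'C(n, l)%:R * n%:R^-1 ^+ l * (A ^+ l) i j.
  rewrite addrC exprD1n big_mkord summxE; apply: eq_bigr => l _.
  by rewrite mx_expZ -scaler_nat scalerA mxE.
(* ['C(n, l)] times [l!] is a falling factorial with [l] factors, hence at most [n^l]. *)
have w0 l : 0 <= w l.
  rewrite /w subr_ge0 exprVn ler_pdivrMr; last first.
    by rewrite exprn_gt0 // ltr0n.
  rewrite ler_pdivlMl ?ltr0n ?fact_gt0 // -natrX -natrM mulnC bin_ffact ler_nat.
  elim: (l) (n) => [|l' IH] n' //; rewrite ffactnS expnS leq_mul2l.
  apply/orP; right; apply: leq_trans (IH _) _.
  by case: (l') => // l''; rewrite leq_exp2r // leq_pred.
(* Binomial coefficients vanish beyond [n], so the finite sums extend to [m'] terms and compare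
   termwise with the exponential series. *)
have big0 m' (F : nat -> R) : (n.+1 <= m')%N ->
    \sum_(0 <= l < m') 'C(n, l)%:R * n%:R^-1 ^+ l * F l =
    \sum_(0 <= l < n.+1) 'C(n, l)%:R * n%:R^-1 ^+ l * F l.
  move=> nm; rewrite (big_cat_nat _ nm) //= [X in _ + X]big1_seq ?addr0 //.
  move=> l /andP[_]; rewrite mem_index_iota => /andP[nl _].
  by rewrite bin_small // !mul0r.
have step m' : (n.+1 <= m')%N ->
    `|expmx_partial_entry A i j m' - ((1%:M + n%:R^-1 *: A) ^+ n) i j| <=
    series (exp_coeff c) m' - (1 + n%:R^-1 * c) ^+ n.
  move=> nm; rewrite expmx_partial_entryE binmxE binE -!(big0 m') //.
  rewrite /series /= -!sumrB; apply: le_trans (ler_norm_sum _ _ _) _.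
  apply: ler_sum => l _; rewrite -mulrBl -/(w l) normrM ger0_norm //.
  rewrite mulrC /exp_coeff /= [X in X - _]mulrC -mulrBl -/(w l) [leRHS]mulrC.
  by rewrite ler_wpM2r //; exact: row_sum_le_entry (row_sum_leX l c0 hA).
have cl : (fun m' => `|expmx_partial_entry A i j m' -
    ((1%:M + n%:R^-1 *: A) ^+ n) i j|) @ \oo -->
    `|expmx A i j - ((1%:M + n%:R^-1 *: A) ^+ n) i j|.
  by apply: cvg_norm; apply: cvgB; [exact: cvg_expmx_entry|exact: cvg_cst].
have cr : (fun m' => series (exp_coeff c) m' - (1 + n%:R^-1 * c) ^+ n) @ \oo -->
    expR c - (1 + n%:R^-1 * c) ^+ n.
  by apply: cvgB; [exact: is_cvg_series_exp_coeff|exact: cvg_cst].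
apply: ler_cvg_to cl cr _; exists n.+1 => // m' /=; exact: step.
Qed.

Let half_pow k : R := ((2 ^ k)%N%:R)^-1.

Lemma cvg_half_pow : half_pow @ \oo --> (0 : R).
Proof.
have := @cvg_geometric R 1 (2^-1); rewrite ger0_norm ?invr_ge0 ?ler0n //.
rewrite invf_lt1 ?ltr0n // ltr1n => /(_ erefl).
suff -> : geometric 1 2^-1 = half_pow by [].
by apply/funext => k; rewrite /geometric /= mul1r /half_pow natrX exprVn.
Qed.

(* The term [Z / n] absorbs the error of [(1 + S / n) (1 + T / n)] with respect to
   [1 + (S + T) / n]. *)
Lemma cvg_exp1D_expmx S Z i j :
  (fun k => ((1%:M + half_pow k *: (S + half_pow k *: Z)) ^+ (2 ^ k)) i j)
    @ \oo --> expmx S i j.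
Proof.
have [c c0 hS] := row_sum_le_exists S; have [z z0 hZ] := row_sum_le_exists Z.
(* The first summand pays for replacing [exp S] by [(1 + S / n)^n], the second for inserting the
   perturbation [Z / n]. *)
pose C := expR c * c ^+ 2 + z * expR (c + z).
have cC : (fun k => half_pow k * C) @ \oo --> (0 : R).
  by rewrite -(mul0r C); apply: cvgM; [exact: cvg_half_pow|exact: cvg_cst].
apply/cvgrPdist_le => e e0.
have [K _ hK] : \forall k \near \oo, half_pow k * C <= e /\ c ^+ 2 + c <= (2 ^ k)%N%:R.
  have near1 : \forall k \near \oo, half_pow k * C <= e.
    have /cvgrPdist_le /(_ e e0) := cC; apply: filterS => k.
    by rewrite sub0r normrN; apply: le_trans (ler_norm _).
  apply: filterS2 near1 (nbhs_infty_ger (c ^+ 2 + c)) => k h1 h2; split=> //.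
  by apply: le_trans h2 _; rewrite ler_nat ltnW // ltn_expl.
exists K => // k Kk; have [hk1 hk2] := hK _ Kk.
have h0 : 0 <= half_pow k by rewrite invr_ge0 ler0n.
have h1 : half_pow k <= 1.
  by rewrite invf_le1 ?ltr0n ?ler1n expn_gt0.
apply: le_trans hk1.
have -> : expmx S i j - ((1%:M + half_pow k *: (S + half_pow k *: Z)) ^+ (2 ^ k)) i j
   = (expmx S i j - ((1%:M + half_pow k *: S) ^+ (2 ^ k)) i j) +
     ((1%:M + half_pow k *: S) ^+ (2 ^ k) -
      (1%:M + half_pow k *: (S + half_pow k *: Z)) ^+ (2 ^ k)) i j.
  by rewrite !mxE addrA subrK.
apply: le_trans (ler_normD _ _) _; rewrite /C mulrDr lerD //.
  apply: (le_trans (expmx_sub_exp1D_le _ _ _ c0 hS)); first by rewrite expn_gt0.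
  apply: (le_trans (ler_norm _)); apply: expR_sub_exp1D_le.
  - by rewrite expn_gt0.
  - by apply: le_trans hk2; rewrite lerDl.
  - by rewrite ger0_norm //; apply: le_trans hk2; rewrite lerDr sqr_ge0.
have hA : row_sum_le (1%:M + half_pow k *: S) (1 + half_pow k * (c + z)).
  have -> : 1%:M + half_pow k *: S = 1%:M + half_pow k *: (S + 0) by rewrite addr0.
  apply: row_sum_leD row_sum_le1 _; rewrite -[X in X * _]ger0_norm //.
  apply: row_sum_leZ; apply: row_sum_leD => // i'.
  by under eq_bigr do rewrite mxE normr0; rewrite sumr_const mul0rn.
have hB : row_sum_le (1%:M + half_pow k *: (S + half_pow k *: Z)) (1 + half_pow k * (c + z)).
  apply: row_sum_leD row_sum_le1 _; rewrite -[X in X * _]ger0_norm //.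
  apply: row_sum_leZ; apply: row_sum_leD => // i'.
  apply: le_trans (row_sum_leZ _ hZ _) _.
  by rewrite ger0_norm // ler_piMl.
have hAB : row_sum_le (1%:M + half_pow k *: S -
    (1%:M + half_pow k *: (S + half_pow k *: Z))) (half_pow k * (half_pow k * z)).
  have -> : 1%:M + half_pow k *: S - (1%:M + half_pow k *: (S + half_pow k *: Z)) =
      - (half_pow k *: (half_pow k *: Z)).
    by rewrite scalerDr opprD addrACA subrr add0r opprD addrA subrr add0r.
  apply: row_sum_leN; rewrite -[X in X * _]ger0_norm //; apply: row_sum_leZ.
  by rewrite -[X in X * _]ger0_norm //; apply: row_sum_leZ.
have hz0 : 0 <= half_pow k * (c + z) by rewrite mulr_ge0 // addr_ge0.
have a0 : 0 <= 1 + half_pow k * (c + z) by rewrite addr_ge0.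
have [n nE] : exists n, (2 ^ k)%N = n.+1.
  by exists (2 ^ k).-1; rewrite prednK // expn_gt0.
rewrite nE.
apply: (le_trans (row_sum_le_entry i j (row_sum_le_subX n a0 _ hA hB hAB))).
  by rewrite !mulr_ge0.
have -> : n.+1%:R * (half_pow k * (half_pow k * z) * (1 + half_pow k * (c + z)) ^+ n) =
    half_pow k * (z * (1 + half_pow k * (c + z)) ^+ n).
  by rewrite /half_pow nE !mulrA divff ?pnatr_eq0 // mul1r.
rewrite ler_wpM2l // ler_wpM2l //.
apply: (@le_trans _ _ ((1 + half_pow k * (c + z)) ^+ n.+1)).
  by rewrite exprS ler_peMl ?exprn_ge0 // lerDl.
by rewrite -nE /half_pow exp1D_div_le_expR ?expn_gt0 ?addr_ge0.
Qed.

End MatrixExponentialLimit.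

(** * Cauchy-Schwarz and the pairing of positive semidefinite matrices *)

Section PsdProduct.
Variables (R : realType) (N : nat).
Implicit Types (A P Q X : 'M[R]_N) (u v : 'rV[R]_N).

Lemma psd_quad_comb A u v (x y : R) : A^T = A ->
  ((x *: u + y *: v) *m A *m (x *: u + y *: v)^T) 0 0 =
  x ^+ 2 * (u *m A *m u^T) 0 0 + 2 * (x * y * (u *m A *m v^T) 0 0)
    + y ^+ 2 * (v *m A *m v^T) 0 0.
Proof.
move=> sA; have symA : (v *m A *m u^T) 0 0 = (u *m A *m v^T) 0 0.
  have -> : v *m A *m u^T = (u *m A *m v^T)^T by rewrite !trmx_mul trmxK sA mulmxA.
  by rewrite mxE.
rewrite linearD !linearZ /= mulmxDr !mulmxDl -!scalemxAr -!scalemxAl.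
have addE (M1 M2 : 'M[R]_1) : (M1 + M2) 0 0 = M1 0 0 + M2 0 0 by rewrite mxE.
have scaleE c (M1 : 'M[R]_1) : (c *: M1) 0 0 = c * M1 0 0 by rewrite mxE.
by rewrite !(addE, scaleE) symA; ring.
Qed.

Lemma psd_cauchy_schwarz A u v : psd A ->
  (u *m A *m v^T) 0 0 ^+ 2 <= (u *m A *m u^T) 0 0 * (v *m A *m v^T) 0 0.
Proof.
move=> [sA pA].
set a := (u *m A *m u^T) 0 0; set b := (u *m A *m v^T) 0 0.
set c := (v *m A *m v^T) 0 0.
have H x y : 0 <= x ^+ 2 * a + 2 * (x * y * b) + y ^+ 2 * c.
  by rewrite -psd_quad_comb.
have a0 : 0 <= a by apply: pA.
have [c0|c0|c0] := ltgtP c 0.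
- by have := pA v; rewrite -/c leNgt c0.
- by have := H c (- b); clear -c0; nra.
rewrite c0 mulr0; have [->|b0] := eqVneq b 0; first by rewrite expr0n.
have b2 : 0 < b ^+ 2 by rewrite exprn_even_gt0.
(* With [c = 0] the form is affine in [y]; at this point it equals [a - 2 (a + 1)], which is
   negative. *)
have := H 1 (- ((a + 1) / b)); rewrite c0 mulr0 addr0 expr1n !mul1r mulNr divfK //.
lra.
Qed.

Lemma psd_diag_ge0 A i : psd A -> 0 <= A i i.
Proof.
by move=> [_ /(_ (delta_mx 0 i))]; rewrite -rowE trmx_delta -colE !mxE.
Qed.

Lemma psd_entry_sqr_le A i j : psd A -> A i j ^+ 2 <= A i i * A j j.
Proof.
move=> /(@psd_cauchy_schwarz _ (delta_mx 0 i) (delta_mx 0 j)).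
by rewrite -!rowE !trmx_delta -!colE !mxE.
Qed.

(* Subtracting the rank-one matrix [P e_i e_i^T P / P_ii] keeps [P]
   positive semidefinite and annihilates its row [i]. *)
Lemma mxtrace_mul_psd_ge0 P Q : psd P -> psd Q -> 0 <= \tr (P *m Q).
Proof.
(* Induction on the number of nonzero diagonal entries. When there are none, [P] vanishes because
   [P_ij^2 <= P_ii P_jj]. *)
move=> pP pQ; have [n] := ubnP #|[pred i | P i i != 0]|.
elim: n P pP => // n IH P pP; rewrite ltnS => cardP.
have [P0|/existsP[i Pi]] := boolP [forall i, P i i == 0].
  suff -> : P = 0 by rewrite mul0mx mxtrace0.
  apply/matrixP => i j; rewrite mxE; apply/eqP; rewrite -sqrf_eq0 eq_le sqr_ge0.
  rewrite andbT; have := psd_entry_sqr_le i j pP.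
  by rewrite (eqP (forallP P0 i)) mul0r.
have sP := pP.1.
have Pi0 : 0 < P i i by rewrite lt_neqAle eq_sym Pi psd_diag_ge0.
have PrE r : P r i = P i r by rewrite -[in LHS]sP mxE.
pose P' := P - (P i i)^-1 *: ((row i P)^T *m row i P).
have P'E r s : P' r s = P r s - (P i i)^-1 * (P r i * P i s).
  by rewrite !mxE big_ord1 !mxE PrE.
have pP' : psd P'.
  split; first by rewrite linearB linearZ /= trmx_mul trmxK sP.
  (* Nonnegativity of the form of [P'] at [u] is exactly Cauchy-Schwarz for [P] between [u] and
     [e_i]. *)
  move=> u; have := psd_cauchy_schwarz u (delta_mx 0 i) pP.
  rewrite -(rowE i P) !trmx_delta -!colE [X in _ * X]mxE [(row i P) 0 i]mxE.
  rewrite [(col i (u *m P)) 0 0]mxE => cs.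
  have rowuE : (u *m ((row i P)^T *m row i P) *m u^T) 0 0 = ((u *m P) 0 i) ^+ 2.
    have uE : (u *m (row i P)^T) 0 0 = (u *m P) 0 i.
      by rewrite tr_row sP colE mulmxA -colE mxE.
    have -> : u *m ((row i P)^T *m row i P) *m u^T =
      (u *m (row i P)^T) *m (row i P *m u^T) by rewrite !mulmxA.
    have mul11 (x y : 'M[R]_1) : (x *m y) 0 0 = x 0 0 * y 0 0.
      by rewrite mxE big_ord1.
    rewrite mul11 expr2; congr (_ * _); first exact: uE.
    have -> : row i P *m u^T = (u *m (row i P)^T)^T by rewrite trmx_mul trmxK.
    by rewrite mxE; exact: uE.
  have -> : u *m P' *m u^T = u *m P *m u^T -
      (P i i)^-1 *: (u *m ((row i P)^T *m row i P) *m u^T).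
    by rewrite mulmxBr mulmxBl -scalemxAr -scalemxAl.
  have subE (M1 M2 : 'M[R]_1) : (M1 - (P i i)^-1 *: M2) 0 0 =
    M1 0 0 - (P i i)^-1 * M2 0 0 by rewrite !mxE.
  by rewrite subE rowuE subr_ge0 ler_pdivrMl // mulrC.
have -> : \tr (P *m Q) =
    (P i i)^-1 * (row i P *m Q *m (row i P)^T) 0 0 + \tr (P' *m Q).
  have tE : \tr ((row i P)^T *m row i P *m Q) = (row i P *m Q *m (row i P)^T) 0 0.
    by rewrite -mulmxA mxtrace_mulC trace_mx11.
  by rewrite mulmxBl raddfB /= -scalemxAl mxtraceZ tE addrC subrK.
apply: addr_ge0; first by apply: mulr_ge0; [rewrite invr_ge0 ltW|exact: pQ.2].
apply: IH => //; apply: leq_trans cardP; apply: proper_card.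
apply/properP; split; last first.
  by exists i; rewrite !inE // P'E mulrA mulVf // mul1r subrr eqxx.
apply/fintype.subsetP => j; rewrite !inE P'E; apply: contraNneq => Pj.
have := psd_entry_sqr_le i j pP; rewrite Pj mulr0 => h.
have -> : P i j = 0 by apply/eqP; rewrite -sqrf_eq0 eq_le sqr_ge0 h.
by rewrite !mulr0 subrr.
Qed.

(** Diagonal dominance: bound [2 u_i A_ij u_j] by [(u_i^2 + u_j^2) |A_ij|] and sum. *)
Lemma row_sum_le1_psd A : A^T = A -> row_sum_le A 1 -> psd (1%:M - A).
Proof.
move=> sA hA; split; first by rewrite linearB /= trmx1 sA.
move=> u; rewrite mulmxBr mulmx1 mulmxBl mxE [X in _ + X]mxE subr_ge0 quad_formE.
have -> : (u *m u^T) 0 0 = \sum_i u 0 i ^+ 2.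
  by rewrite mxE; apply: eq_bigr => i _; rewrite mxE expr2.
have key i j : 2 * (u 0 i * A i j * u 0 j) <=
    u 0 i ^+ 2 * `|A i j| + u 0 j ^+ 2 * `|A j i|.
  have -> : A j i = A i j by rewrite -[in LHS]sA mxE.
  have h1 := ler_norm (A i j); have := ler_norm (- A i j); rewrite normrN => h2.
  have := sqr_ge0 (u 0 i + u 0 j); have := sqr_ge0 (u 0 i - u 0 j).
  nra.
rewrite -(ler_pM2l (ltr0Sn R 1)) mulr_sumr.
apply: (@le_trans _ _ (\sum_i \sum_j
    (u 0 i ^+ 2 * `|A i j| + u 0 j ^+ 2 * `|A j i|))).
  by apply: ler_sum => i _; rewrite mulr_sumr; apply: ler_sum => j _; exact: key.
under eq_bigr do rewrite big_split /=.
rewrite big_split /= [X in _ + X]exchange_big /= mulr_natl mulr2n.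
by apply: lerD; apply: ler_sum => i _; rewrite -mulr_sumr ler_piMr ?sqr_ge0.
Qed.

End PsdProduct.

(** * Passage to the limit: trace inequalities for the matrix exponential *)

Section TraceExponential.
Variables (R : realType) (N : nat).
Implicit Types (A L M S X Z : 'M[R]_N).

Lemma cvg_mxtrace_mul M (F : nat -> 'M[R]_N) L :
  (forall i j, (fun k => F k i j) @ \oo --> L i j) ->
  (fun k => \tr (M *m F k)) @ \oo --> \tr (M *m L).
Proof.
move=> h; rewrite /mxtrace; apply: cvg_big => [|i _]; first exact: add_continuous.
under eq_cvg do rewrite mxE.
rewrite mxE; apply: cvg_big => [|j _]; first exact: add_continuous.
by apply: cvgM; [exact: cvg_cst|exact: h].
Qed.

Lemma cvg_mxtrace (F : nat -> 'M[R]_N) L :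
  (forall i j, (fun k => F k i j) @ \oo --> L i j) ->
  (fun k => \tr (F k)) @ \oo --> \tr L.
Proof.
move=> h; have := @cvg_mxtrace_mul 1%:M F L h; rewrite mul1mx.
by under eq_fun do rewrite mul1mx.
Qed.

Lemma cvg_expmx_pow2 S i j :
  (fun k => ((1%:M + ((2 ^ k)%N%:R)^-1 *: S) ^+ (2 ^ k)) i j) @ \oo --> expmx S i j.
Proof.
have := @cvg_exp1D_expmx R N S 0 i j.
by under eq_fun do rewrite scaler0 addr0.
Qed.

Lemma cvg_expR_pow2 (x : R) :
  (fun k => (1 + ((2 ^ k)%N%:R)^-1 * x) ^+ (2 ^ k)) @ \oo --> expR x.
Proof.
have cC : (fun k => ((2 ^ k)%N%:R)^-1 * (expR x * x ^+ 2)) @ \oo --> (0 : R).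
  rewrite -(mul0r (expR x * x ^+ 2)).
  by apply: cvgM; [exact: cvg_half_pow|exact: cvg_cst].
apply/cvgrPdist_le => e e0.
have near1 : \forall k \near \oo, ((2 ^ k)%N%:R)^-1 * (expR x * x ^+ 2) <= e.
  have /cvgrPdist_le /(_ e e0) := cC; apply: filterS => k.
  by rewrite sub0r normrN; apply: le_trans (ler_norm _).
apply: filterS2 near1 (nbhs_infty_ger (x ^+ 2 + `|x|)) => k h1 h2.
apply: le_trans h1; have h3 : x ^+ 2 + `|x| <= (2 ^ k)%N%:R.
  by apply: le_trans h2 _; rewrite ler_nat ltnW // ltn_expl.
apply: expR_sub_exp1D_le; first by rewrite expn_gt0.
  by apply: le_trans h3; rewrite lerDl.
by apply: le_trans h3; rewrite lerDr sqr_ge0.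
Qed.

(* Golden-Thompson followed by [exp (eta M) <= 1 + (e^eta - 1) M]. *)
Lemma mxtrace_expmxD_le S M (eta : R) :
  S^T = S -> psd M -> psd (1%:M - M) -> 0 <= eta ->
  \tr (expmx (S + eta *: M)) <=
  \tr (expmx S) + (expR eta - 1) * \tr (M *m expmx S).
Proof.
move=> sS pM p1M eta0.
pose h k : R := ((2 ^ k)%N%:R)^-1.
(* The perturbation is the cross term of the product [(1 + S / n) (1 + eta M / n)]. *)
have cl := @cvg_mxtrace _ _ (@cvg_exp1D_expmx R N (S + eta *: M) (S *m (eta *: M))).
have c1 := @cvg_mxtrace _ _ (@cvg_expmx_pow2 S).
have c2 := @cvg_mxtrace_mul M _ _ (@cvg_expmx_pow2 S).
have cr : (fun k => \tr ((1%:M + h k *: S) ^+ (2 ^ k)) +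
    (expR eta - 1) * \tr (M *m (1%:M + h k *: S) ^+ (2 ^ k))) @ \oo -->
    \tr (expmx S) + (expR eta - 1) * \tr (M *m expmx S).
  by apply: cvgD => //; apply: cvgM => //; exact: cvg_cst.
apply: ler_cvg_to cl cr _; exists 1%N => // -[|k] _ //=.
apply: le_trans (mxtrace_exp_prod_le k sS pM p1M eta0); rewrite le_eqVlt.
apply/orP; left; apply/eqP; congr (\tr (_ ^+ _)).
rewrite mulmxDr !mulmxDl !mul1mx mulmx1 !scalerDr -!scalemxAl -!scalemxAr -!addrA.
by rewrite /h !scalerA.
Qed.

(** A Peierls-Bogoliubov type bound, the limit of [exp1D_mxtrace_le] along powers of two. *)
Lemma expR_mxtrace_le S X : S^T = S -> psd X -> \tr X = 1 ->
  expR (\tr (S *m X)) <= \tr (expmx S).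
Proof.
move=> sS pX tX.
have cr := @cvg_mxtrace _ _ (@cvg_expmx_pow2 S).
have cl := @cvg_expR_pow2 (\tr (S *m X)); apply: ler_cvg_to cl cr _.
by exists 1%N => // -[|k] _ //=; exact: exp1D_mxtrace_le.
Qed.

(** [expmx S] is a limit of even powers of symmetric matrices; symmetry and nonnegativity of the
    quadratic form pass to the limit. *)
Lemma psd_expmx S : S^T = S -> psd (expmx S).
Proof.
move=> sS; pose F k := (1%:M + ((2 ^ k)%N%:R)^-1 *: S) ^+ (2 ^ k).
have sF k : (1%:M + ((2 ^ k)%N%:R)^-1 *: S)^T = 1%:M + ((2 ^ k)%N%:R)^-1 *: S.
  by rewrite linearD linearZ /= trmx1 sS.
split.
  apply/matrixP => i j; rewrite mxE.
  apply: (cvg_unique _ (@cvg_expmx_pow2 S j i)); first exact: norm_hausdorff.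
  have -> : (fun k => F k j i) = (fun k => F k i j).
    by apply/funext => k; have /matrixP /(_ i j) := trmx_exp (2 ^ k) (sF k); rewrite mxE.
  exact: cvg_expmx_pow2.
move=> u; have E A : (u *m A *m u^T) 0 0 = \tr (u^T *m u *m A).
  by rewrite -trace_mx11 mxtrace_mulC mulmxA.
have cr := @cvg_mxtrace_mul (u^T *m u) _ _ (@cvg_expmx_pow2 S).
have cl : (fun=> 0 : R) @ \oo --> (0 : R) by exact: cvg_cst.
rewrite E; apply: ler_cvg_to cl cr _.
exists 1%N => // -[|k] _ //=; rewrite -E expnS.
by apply: (psd_exp_even _ _).2; rewrite -expnS.
Qed.

Lemma expmx0 : expmx (0 : 'M[R]_N) = 1%:M.
Proof.
apply/matrixP => i j.
apply: (cvg_unique _ (@cvg_expmx_pow2 0 i j)); first exact: norm_hausdorff.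
have -> : (fun k => ((1%:M + ((2 ^ k)%N%:R)^-1 *: (0 : 'M[R]_N)) ^+ (2 ^ k)) i j) =
    (fun=> (1%:M : 'M[R]_N) i j).
  by apply/funext => k; rewrite scaler0 addr0 expr1n.
exact: cvg_cst.
Qed.

End TraceExponential.

Lemma le_ceil_nat (R : realType) (x : R) : x <= (ceil_nat x)%:R.
Proof.
rewrite /ceil_nat natr_absz ger0_norm ?le_max ?lexx //.
by apply: le_trans (ceil_ge x) _; rewrite ler_int le_max lexx orbT.
Qed.

(** * Correctness of both answers of Hamiltonian updates *)

Section HamiltonianUpdatesCorrect.
Variables (R : realType) (N : nat) (J : finType).
Variables (eps : R) (A : J -> 'M[R]_N) (b : J -> R).
Hypotheses (eps_gt0 : 0 < eps) (N_gt1 : (1 < N)%N).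
Hypotheses (symA : forall j, (A j)^T = A j) (normA : forall j, row_sum_le (A j) 1).

Let M j : 'M[R]_N := (1 / 2) *: (1%:M - A j).

Let psdM j : psd (M j).
Proof. by apply: psd_scale; [rewrite divr_ge0|exact: row_sum_le1_psd]. Qed.

Let psd1M j : psd (1%:M - M j).
Proof.
have -> : 1%:M - M j = (1 / 2) *: (1%:M - - A j).
  by apply/matrixP => r s; rewrite !mxE; field.
apply: psd_scale; first by rewrite divr_ge0.
apply: row_sum_le1_psd; first by rewrite linearN /= symA.
exact: row_sum_leN.
Qed.

Let exponent (js : seq J) : 'M[R]_N := (eps / 4) *: \sum_(j <- js) M j.

Let sym_exponent js : (exponent js)^T = exponent js.
Proof.
rewrite linearZ /= raddf_sum /=; congr (_ *: _).
by apply: eq_bigr => j _; exact: (psdM j).1.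
Qed.

Let hu_WE js : hu_W eps A js = expmx (exponent js).
Proof. by case: js => [|j js] //; rewrite /exponent big_nil scaler0 expmx0. Qed.

Let mxtrace_hu_W_gt0 js : 0 < \tr (hu_W eps A js).
Proof.
have N0 : (0 : R) < N%:R by rewrite ltr0n ltnW.
have pX : psd (N%:R^-1 *: 1%:M : 'M[R]_N).
  by apply: psd_scale; [rewrite invr_ge0 ltW|exact: psd_scalar1].
have tX : \tr (N%:R^-1 *: 1%:M : 'M[R]_N) = 1.
  by rewrite mxtraceZ mxtrace1 mulVf ?gt_eqF.
rewrite hu_WE; apply: lt_le_trans (expR_mxtrace_le (sym_exponent js) pX tX).
exact: expR_gt0.
Qed.

Lemma hu_output_true : hu_output eps A b true ->
  exists P, [/\ psd P, \tr P = 1 & forall j, \tr (A j *m P) <= b j + eps].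
Proof.
move=> out; inversion out as [js hjs lt_js nv|]; exists (hu_P eps A js); split.
- apply: psd_scale; first by rewrite invr_ge0 ltW ?mxtrace_hu_W_gt0.
  by rewrite hu_WE; exact: psd_expmx.
- by rewrite mxtraceZ mulVf // gt_eqF ?mxtrace_hu_W_gt0.
- by move=> j; rewrite leNgt; apply/negP; exact: nv.
Qed.

Let mxtrace_M_mul j X : \tr X = 1 -> \tr (M j *m X) = (1 - \tr (A j *m X)) / 2.
Proof.
by move=> tX; rewrite -scalemxAl mulmxBl mul1mx mxtraceZ raddfB /= tX mulrC mul1r.
Qed.

(** Each step multiplies the trace by at most [1 + (e^(eps/4) - 1) tr (M_j P)]. Violation at [P] and
    feasibility of [X] give [tr (M_j P) < tr (M_j X) - eps / 2], and [1 + x <= e^x] turns the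
    product into an exponential. *)
Let potential_le js X : psd X -> \tr X = 1 ->
  (forall j, \tr (A j *m X) <= b j) -> hu_state eps A b js ->
  \tr (hu_W eps A js) <= N%:R * expR ((expR (eps / 4) - 1) *
    (\sum_(j <- js) \tr (M j *m X) - (size js)%:R * (eps / 2))).
Proof.
move=> pX tX feas; elim=> [|js' j st IH lt_js viol].
  by rewrite big_nil mul0r subr0 mulr0 expR0 mulr1 /= mxtrace1.
set y := expR (eps / 4) - 1 in IH *.
have y0 : 0 <= y by rewrite subr_ge0 -expR0 ler_expR divr_ge0 // ltW.
set W := hu_W eps A js' in IH; set w := \tr W in IH.
have w0 : 0 < w := mxtrace_hu_W_gt0 js'.
have WP : W = w *: hu_P eps A js' by rewrite /hu_P scalerA divff ?scale1r ?gt_eqF.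
have tP : \tr (hu_P eps A js') = 1 by rewrite mxtraceZ mulVf ?gt_eqF.
have step : \tr (hu_W eps A (rcons js' j)) <= w + y * \tr (M j *m W).
  rewrite {1}hu_WE /exponent -cats1 big_cat big_seq1 scalerDr.
  rewrite /w /W !hu_WE; apply: (mxtrace_expmxD_le (sym_exponent js') (psdM j) (psd1M j)).
  by rewrite divr_ge0 // ltW.
apply: (le_trans step).
have -> : \tr (M j *m W) = w * \tr (M j *m hu_P eps A js').
  by rewrite {1}WP -scalemxAr mxtraceZ.
rewrite mxtrace_M_mul //; have := viol; rewrite /hu_violated.
set q := \tr (A j *m _) => vq.
rewrite -cats1 big_cat big_seq1 /= size_cat /= natrD.
set hX := \sum_(i <- js') _ in IH *; set s := size js' in IH *.
have fj := feas j; rewrite mxtrace_M_mul //; set p := \tr (A j *m X) in fj *.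
have le1 : w + y * (w * ((1 - q) / 2)) <=
    w * expR (y * ((1 - p) / 2 - eps / 2)).
  have -> : w + y * (w * ((1 - q) / 2)) = w * (1 + y * ((1 - q) / 2)) by ring.
  rewrite ler_pM2l //; apply: le_trans (expR_ge1Dx _) _; rewrite ler_expR.
  by rewrite ler_wpM2l //; lra.
apply: (le_trans le1).
have -> : y * (hX + (1 - p) / 2 - (s%:R + 1%:R) * (eps / 2)) =
    y * (hX - s%:R * (eps / 2)) + y * ((1 - p) / 2 - eps / 2) by ring.
by rewrite expRD mulrA ler_wpM2r ?expR_ge0.
Qed.

(** With [e = eps / 4] and [h] the sum of the [tr (M_j X)], comparing the two bounds on [tr W] gives
    [e h <= ln N + (exp e - 1) (h - 2 e t)]. This is impossible when [h <= t] and
    [ln N <= e^2 t]. *)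
Lemma hu_output_false X : hu_output eps A b false ->
  psd X -> \tr X = 1 -> ~ forall j, \tr (A j *m X) <= b j.
Proof.
move=> out pX tX feas; inversion out as [|js st szT].
have N0 : (0 : R) < N%:R by rewrite ltr0n ltnW.
have lnN : 0 < ln (N%:R : R) by rewrite ln_gt0 // ltr1n.
pose e := eps / 4; have e0 : 0 < e by rewrite divr_gt0.
pose t : R := (size js)%:R.
(* The number of steps, at least [16 ln N / eps^2], is chosen for this bound. *)
have tE : ln N%:R <= e ^+ 2 * t.
  have : 16 * ln (N%:R : R) / eps ^+ 2 <= t by rewrite /t szT le_ceil_nat.
  rewrite ler_pdivrMr ?exprn_gt0 // /e => h.
  have -> : (eps / 4) ^+ 2 * t = t * eps ^+ 2 / 16 by field.
  lra.
have t0 : 0 < t.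
  have := lt_le_trans lnN tE; rewrite pmulr_rgt0 ?exprn_gt0 //.
have up := potential_le pX tX feas st.
have lo := expR_mxtrace_le (sym_exponent js) pX tX; rewrite -hu_WE in lo.
have := le_trans lo up; rewrite -{1}(lnK (x := N%:R)) ?posrE // -expRD ler_expR.
rewrite -scalemxAl mxtraceZ mulmx_suml raddf_sum /=.
set h := \sum_(j <- js) _; rewrite -/e -/t => key.
have ht : h <= t.
  rewrite /h /t -sum1_size natr_sum; apply: ler_sum => j _.
  have := mxtrace_mul_psd_ge0 (psd1M j) pX.
  by rewrite mulmxBl mul1mx raddfB /= tX subr_ge0.
have y0 : 0 < expR e - 1 - e.
  by have := expR_gt1Dx (lt0r_neq0 e0); lra.
(* This is [e^e (1 - e) <= 1] minus [(1 + e) (1 - e)]. Subtracting the positive [y e] later makes it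
   the strict bound [y (1 - 2 e) < e^2]. *)
have y1 : (expR e - 1 - e) * (1 - e) <= e ^+ 2.
  have := ler_wpM2l (expR_ge0 e) (expR_ge1Dx (- e)).
  by rewrite expRN divff ?gt_eqF ?expR_gt0 //; lra.
set y := expR e - 1 - e in y0 y1.
have epsE : eps / 2 = 2 * e by rewrite /e; field.
rewrite epsE (_ : expR e - 1 = y + e) in key; last by rewrite /y; ring.
have s_le : h - t * (2 * e) <= t * (1 - 2 * e) by lra.
have ys : y * (h - t * (2 * e)) <= y * (t * (1 - 2 * e)) by rewrite ler_pM2l.
have : y * (1 - 2 * e) < e ^+ 2.
  by have := mulr_gt0 y0 e0; lra.
move=> h2; have : t * (y * (1 - 2 * e)) < t * e ^+ 2 by rewrite ltr_pM2l.
lra.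
Qed.

End HamiltonianUpdatesCorrect.

(** * The smallest eigenvalue as a lower bound for the quadratic form *)

Section LambdaMin.
Variables (R : realType) (N : nat).
Implicit Types (A D E G : 'M[R]_N) (u v : 'rV[R]_N).

Lemma sqnorm_ge0 u : 0 <= (u *m u^T) 0 0.
Proof. by rewrite mxE; apply: sumr_ge0 => i _; rewrite mxE -expr2 sqr_ge0. Qed.

Lemma sqnorm_gt0 u : u != 0 -> 0 < (u *m u^T) 0 0.
Proof.
move=> u0; rewrite lt_neqAle sqnorm_ge0 andbT eq_sym; apply: contraNneq u0.
rewrite mxE; under eq_bigr do rewrite mxE -expr2.
move=> h; apply/eqP/rowP => i; rewrite mxE; apply/eqP; rewrite -sqrf_eq0.
have /eqP := h; rewrite psumr_eq0 => [/allP /(_ i)|j _]; last exact: sqr_ge0.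
by rewrite mem_index_enum => /(_ erefl).
Qed.

Lemma quad_sub_scalar A (t : R) u :
  (u *m (A - t%:M) *m u^T) 0 0 = (u *m A *m u^T) 0 0 - t * (u *m u^T) 0 0.
Proof.
have subE (M1 M2 : 'M[R]_1) : (M1 - t *: M2) 0 0 = M1 0 0 - t * M2 0 0.
  by rewrite !mxE.
by rewrite mulmxBr mulmxBl mul_mx_scalar -scalemxAl subE.
Qed.

Lemma sym_sub_scalar A (t : R) : A^T = A -> (A - t%:M)^T = A - t%:M.
Proof. by move=> sA; rewrite linearB /= tr_scalar_mx sA. Qed.

Lemma psd_sub_scalar_exists A : A^T = A ->
  exists2 c : R, 0 < c & psd (c%:M - A).
Proof.
move=> sA; have [c c0 hA] := row_sum_le_exists A.
exists (c + 1); first by rewrite ltr_wpDl.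
have c1 : 0 < c + 1 by rewrite ltr_wpDl.
have -> : (c + 1)%:M - A = (c + 1) *: (1%:M - (c + 1)^-1 *: A).
  by rewrite scalerBr scalerA divff ?gt_eqF // scale1r scalemx1.
apply: psd_scale; first exact: ltW.
apply: row_sum_le1_psd; first by rewrite linearZ /= sA.
move=> i; have := @row_sum_leZ _ _ (c + 1)^-1 _ _ hA i => /le_trans; apply.
rewrite ger0_norm ?invr_ge0 ?(ltW c1) // ler_pdivrMl // mulr1; lra.
Qed.

(** Cauchy-Schwarz for [E] between [u] and [u E^-1] gives [|u|^4 <= (u E u^T) (u E^-1 u^T)]; an
    upper bound [c] on [E^-1] then yields [t = 1 / c]. *)
Lemma psd_unit_sub_scalar E : psd E -> E \in unitmx ->
  exists2 t : R, 0 < t & psd (E - t%:M).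
Proof.
move=> pE uE; have sE := pE.1; pose F := invmx E.
have sF : F^T = F by rewrite /F trmx_inv sE.
have [c c0 pF] := psd_sub_scalar_exists sF.
exists c^-1; rewrite ?invr_gt0 //; split; first exact: sym_sub_scalar.
move=> u; rewrite quad_sub_scalar subr_ge0.
have cs := psd_cauchy_schwarz u (u *m F) pE.
have e1 : u *m E *m (u *m F)^T = u *m u^T.
  by rewrite trmx_mul sF -!mulmxA (mulmxA E) mulmxV // mul1mx.
have e2 : u *m F *m E *m (u *m F)^T = u *m F *m u^T.
  by rewrite trmx_mul sF -(mulmxA u F E) mulVmx // mulmx1 mulmxA.
rewrite e1 e2 in cs; have := pF.2 u.
have subE (M1 M2 : 'M[R]_1) : (c *: M1 - M2) 0 0 = c * M1 0 0 - M2 0 0.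
  by rewrite !mxE.
rewrite mulmxBr mulmxBl mul_mx_scalar -scalemxAl subE subr_ge0 => hF.
have qE := pE.2 u; rewrite ler_pdivrMl //.
have [->|u0] := eqVneq u 0; first by rewrite !mul0mx mxE mulr0.
have s0 := sqnorm_gt0 u0.
rewrite -(ler_pM2r s0) -expr2; apply: (le_trans cs).
by rewrite [leRHS]mulrAC [leRHS]mulrC; apply: ler_wpM2l.
Qed.

(* The largest [t] with [D - t I] positive semidefinite is an eigenvalue:
   otherwise [D - t I] would be invertible, hence bounded below. *)
Lemma psd_sub_lambda_min D : (0 < N)%N -> D^T = D -> psd (D - (lambda_min D)%:M).
Proof.
move=> N0 sD; pose i0 := Ordinal N0.
pose T := [set t : R | psd (D - t%:M)]; pose rho := sup T.
have T0 : T !=set0.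
  have sND : (- D)^T = - D by rewrite linearN /= sD.
  have [c _ pc] := psd_sub_scalar_exists sND.
  have e : c%:M - - D = D - (- c)%:M.
    by apply/matrixP => i j; rewrite !mxE mulNrn !opprK addrC.
  by exists (- c); rewrite e in pc.
have Tub : ubound T (D i0 i0).
  move=> t /psd_diag_ge0 - /(_ i0); rewrite !mxE eqxx mulr1n; lra.
have supT : has_sup T by split=> //; exists (D i0 i0).
have pr : psd (D - rho%:M).
  split; first exact: sym_sub_scalar.
  move=> u; rewrite quad_sub_scalar subr_ge0.
  have [->|u0] := eqVneq u 0; first by rewrite !mul0mx mxE mulr0.
  have s0 := sqnorm_gt0 u0; rewrite -ler_pdivlMr //; apply: ge_sup => // t [_ pt].
  by rewrite ler_pdivlMr // -subr_ge0 -quad_sub_scalar.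
have eig : eigenvalue D rho.
  rewrite /eigenvalue /eigenspace kermx_eq0 row_free_unit; apply/negP => uE.
  have [t t0 pt] := psd_unit_sub_scalar pr uE.
  have : T (rho + t).
    have e : D - rho%:M - t%:M = D - (rho + t)%:M.
      by apply/matrixP => i j; rewrite !mxE mulrnDl opprD addrA.
    by rewrite e in pt.
  by move/(sup_ubound (ex_intro _ _ Tub)); rewrite -/rho; lra.
(* The infimum defining [lambda_min] lies below the eigenvalue [rho] only if the spectrum is known
   to be bounded below. *)
have lb : lbound [set l | eigenvalue D l] rho.
  move=> l /eigenvalueP[v vD v0]; have := pr.2 v.
  have s0 := sqnorm_gt0 v0.
  rewrite quad_sub_scalar vD -scalemxAl.
  by rewrite [X in X - _]mxE -mulrBl pmulr_lge0 // subr_ge0.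
have le_rho : lambda_min D <= rho by apply: ge_inf => //; exists rho.
have -> : D - (lambda_min D)%:M = (D - rho%:M) + (rho - lambda_min D) *: 1%:M.
  by apply/matrixP => i j; rewrite !mxE; case: eqP => _; rewrite ?mulr1n ?mulr0n; ring.
apply: psd_add => //; apply: psd_scale; last exact: psd_scalar1.
by rewrite subr_ge0.
Qed.

Lemma lambda_min_mxtrace_le D G : (0 < N)%N -> D^T = D -> psd G ->
  lambda_min D * \tr G <= \tr (D *m G).
Proof.
move=> N0 sD pG; have := mxtrace_mul_psd_ge0 (psd_sub_lambda_min N0 sD) pG.
by rewrite mulmxBl raddfB /= mul_scalar_mx mxtraceZ subr_ge0.
Qed.

End LambdaMin.

(** * Block diagonal matrices *)

Section BlockDiagonal.
Variables (R : realType) (q : nat) (p_ : 'I_q -> nat).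
Implicit Types B G : forall i, 'M[R]_(p_ i).

Lemma mul_mxdiag B G : \mxdiag_i B i *m \mxdiag_i G i = \mxdiag_i (B i *m G i).
Proof.
rewrite {2}/mxdiag mul_mxdiag_mxblock /mxdiag; apply: eq_mxblock => i j.
by case: eqVneq => [->|_]; rewrite ?conform_mx_id ?mulmx0.
Qed.

Lemma scale_mxdiag (c : R) B : c *: \mxdiag_i B i = \mxdiag_i (c *: B i).
Proof.
rewrite -mul_scalar_mx -mxdiagZ mul_mxdiag.
by apply: eq_mxdiag => i; rewrite mul_scalar_mx.
Qed.

Lemma psd_mxdiag B : (forall i, psd (B i)) -> psd (\mxdiag_i B i).
Proof.
move=> pB; split.
  by rewrite tr_mxdiag; apply: eq_mxdiag => i; exact: (pB i).1.
move=> u; rewrite -(submxrowK u) mul_mxrow_mxdiag tr_mxrow mul_mxrow_mxcol summxE.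
by apply: sumr_ge0 => i _; exact: (pB i).2.
Qed.

End BlockDiagonal.

(** * Polynomials as sums over multi-indices of bounded degree *)

Section PolynomialSums.
Variables (R : realType) (n : nat).
Implicit Types (p : mpoly n R) (a b c : multinom n) (x : n.-tuple R).

Lemma sum_msupp p T (F : multinom n -> R) : (mmeasure (@mdeg n) p <= T)%N ->
  \sum_(a <- msupp p) mcoeff a p * F a =
  \sum_(a : bmultinom n T) mcoeff a p * F a.
Proof.
move=> le_pT; rewrite (ssrcomplements.big_mksub (bmultinom n T)) //=; first last.
- by move=> a /msize_mdeg_lt /leq_trans; apply.
- by rewrite msupp_uniq.
by rewrite big_rmcond //= => a; move/memN_msupp_eq0 ->; rewrite mul0r.
Qed.

Lemma msize_le_half_degree p :
  (mmeasure (@mdeg n) p <= (2 * half_degree p).+1)%N.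
Proof.
rewrite /half_degree /mdegree; apply: leq_trans (leqSpred _) _; rewrite ltnS.
rewrite -{1}[_.-1]odd_double_half uphalf_half mul2n doubleD leq_add2r.
by case: (odd _).
Qed.

Lemma monomial_funD a b x :
  monomial_fun (mnm_add a b) x = monomial_fun a x * monomial_fun b x :> R.
Proof. by rewrite /monomial_fun /peval mpolyXD mevalM. Qed.

Lemma pevalE p x : peval p x = \sum_(a <- msupp p) mcoeff a p * monomial_fun a x.
Proof.
rewrite /monomial_fun /peval {1}[p]mpolyE raddf_sum /=.
by apply: eq_bigr => a _; rewrite mevalZ.
Qed.

Lemma mdeg_mnth t (i : 'I_(mnum n t)) : (mdeg (mnth i) <= t)%N.
Proof. by rewrite -ltnS; exact: bmdeg. Qed.

Lemma mcoeff_mulX p T a c : (mmeasure (@mdeg n) p <= T)%N ->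
  mcoeff c (p * mpolyX R a) =
  \sum_(z : bmultinom n T) mcoeff z p * (mnm_add z a == c)%:R.
Proof.
move=> le_pT; rewrite {1}(mpolywE le_pT) mulr_suml raddf_sum /=.
by apply: eq_bigr => z _; rewrite -scalerAl -mpolyXD mcoeffZ mcoeffX.
Qed.

Lemma mnm_subE a b c : mpoly.lem a c -> (b == mnm_sub c a) = (mnm_add a b == c).
Proof.
move=> le_ac; rewrite -(inj_eq (@addIm n a)) submK //.
by rewrite addmC.
Qed.

End PolynomialSums.

(** * Coefficient matrices and their duality with localizing matrices *)

Section CoefficientMatrices.
Variables (R : realType) (n m : nat).
Variables (g : 'I_m.+1 -> mpoly n R) (k : nat).

Definition coef_block (i : 'I_m.+1) (c : multinom n) : 'M[R]_(block_size g k i) :=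
  \sum_(z : bmultinom n (2 * half_degree (g i)).+1 | mpoly.lem z c)
    mcoeff z (g i) *: Bmx g k i (mnm_sub c z).

Lemma coef_blockE i c r s : coef_block i c r s =
  \sum_(z : bmultinom n (2 * half_degree (g i)).+1)
    mcoeff z (g i) * (mnm_add z (mnm_add (mnth r) (mnth s)) == c)%:R.
Proof.
rewrite /coef_block summxE big_mkcond /=; apply: eq_bigr => z _.
case: ifP => [le_zc|nle]; first by rewrite !mxE mnm_subE.
case: eqP => [e|_]; last by rewrite mulr0.
by rewrite -e lem_addr in nle.
Qed.

Lemma pm_atE (y : pseudo_moments R n k) a (lt_a : (mdeg a < (2 * k).+1)%N) :
  pm_at y a = y (BMultinom lt_a).
Proof. by rewrite /pm_at insubT. Qed.

Lemma pm_at_sum (y : pseudo_moments R n k) a : (mdeg a < (2 * k).+1)%N ->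
  \sum_(c : bmultinom n (2 * k).+1) y c * (a == c)%:R = pm_at y a.
Proof.
move=> lt_a; rewrite (bigD1 (BMultinom lt_a)) //= eqxx mulr1 big1 ?addr0.
  by rewrite pm_atE.
by move=> c; rewrite bmeqP /= eq_sym => /negbTE ->; rewrite mulr0.
Qed.

Lemma mdeg_block_lt i (r s : 'I_(block_size g k i))
    (z : bmultinom n (2 * half_degree (g i)).+1) :
  (half_degree (g i) <= k)%N ->
  (mdeg (mnm_add z (mnm_add (mnth r) (mnth s))) < (2 * k).+1)%N.
Proof.
move=> hk; rewrite !mdegD ltnS; have := bmdeg z; rewrite ltnS => hz.
apply: leq_trans (leq_add hz (leq_add (mdeg_mnth r) (mdeg_mnth s))) _.
by rewrite addnn -mul2n -mulnDr /block_degree subnKC.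
Qed.

Lemma localizing_mxE (y : pseudo_moments R n k) i r s :
  localizing_mx g y i r s =
  \sum_(z : bmultinom n (2 * half_degree (g i)).+1)
    mcoeff z (g i) * pm_at y (mnm_add z (mnm_add (mnth r) (mnth s))).
Proof.
rewrite mxE; under eq_bigr do rewrite addmC.
exact: (sum_msupp (fun z => pm_at y (mnm_add z _)) (msize_le_half_degree (g i))).
Qed.

Hypothesis hkg : forall i, (half_degree (g i) <= k)%N.

Lemma localizing_mx_sum (y : pseudo_moments R n k) i :
  localizing_mx g y i = \sum_(c : bmultinom n (2 * k).+1) y c *: coef_block i c.
Proof.
apply/matrixP => r s; rewrite localizing_mxE summxE.
under [RHS]eq_bigr do rewrite mxE coef_blockE mulr_sumr.
rewrite exchange_big /=; apply: eq_bigr => z _.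
rewrite -pm_at_sum ?mdeg_block_lt // mulr_sumr.
by apply: eq_bigr => c _; rewrite mulrCA.
Qed.

(** Pairing [D(y)] with a matrix thereby becomes a combination, weighted by [y], of the constraint
    values of [CON]. *)
Lemma Dmx_sum (y : pseudo_moments R n k) :
  Dmx g y = \sum_(c : bmultinom n (2 * k).+1) y c *: Bgmx g k c.
Proof.
rewrite /Dmx; under eq_mxdiag do rewrite localizing_mx_sum.
by rewrite mxdiag_sum; apply: eq_bigr => c _; rewrite scale_mxdiag.
Qed.

Lemma sym_localizing_mx (y : pseudo_moments R n k) i :
  (localizing_mx g y i)^T = localizing_mx g y i.
Proof.
by apply/matrixP => r s; rewrite !mxE; apply: eq_bigr => z _; rewrite [mnm_add (mnth s) _]addmC.
Qed.

Lemma sym_Dmx (y : pseudo_moments R n k) : (Dmx g y)^T = Dmx g y.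
Proof. by rewrite tr_mxdiag; apply: eq_mxdiag => i; exact: sym_localizing_mx. Qed.

Lemma sym_coef_block i c : (coef_block i c)^T = coef_block i c.
Proof.
apply/matrixP => r s; rewrite mxE !coef_blockE.
by apply: eq_bigr => z _; rewrite [mnm_add (mnth s) _]addmC.
Qed.

Lemma sym_Bgmx c : (Bgmx g k c)^T = Bgmx g k c.
Proof. by rewrite tr_mxdiag; apply: eq_mxdiag => i; exact: sym_coef_block. Qed.

Lemma sos_mcoeff (G : forall i : 'I_m.+1, 'M[R]_(block_size g k i)) c :
  mcoeff c (\sum_i g i *
    (((mon_vec R n (block_degree g k i))^T *m map_mx (@mpolyC n R) (G i)
       *m mon_vec R n (block_degree g k i)) 0 0)) =
  \tr (Bgmx g k c *m \mxdiag_i G i).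
Proof.
rewrite /Bgmx mul_mxdiag mxtrace_mxdiag raddf_sum /=; apply: eq_bigr => i _.
rewrite -/(coef_block i c) /mxtrace mxE mulr_sumr raddf_sum /=.
apply: eq_bigr => s _; rewrite !mxE mulr_suml mulr_sumr raddf_sum /=.
apply: eq_bigr => r _; rewrite !mxE -(sym_coef_block i c) mxE coef_blockE.
rewrite [_ * mpolyC _ _]mulrC -mulrA mul_mpolyC -mpolyXD -scalerAr mcoeffZ mulrC.
by rewrite (mcoeff_mulX _ _ (msize_le_half_degree (g i))).
Qed.

Definition dirac_moments (x : n.-tuple R) : pseudo_moments R n k :=
  fun c => monomial_fun c x.

(** Block [i] is [g_i(x)] times the rank-one matrix of the monomial vector at [x]. *)
Lemma psd_Dmx_dirac x : g ord0 = 1 -> feasible_set g x ->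
  psd (Dmx g (dirac_moments x)).
Proof.
move=> g0 fx; apply: psd_mxdiag => i.
pose v : 'rV[R]_(block_size g k i) := \row_r monomial_fun (mnth r) x.
have -> : localizing_mx g (dirac_moments x) i = peval (g i) x *: (v^T *m v).
  apply/matrixP => r s; rewrite localizing_mxE !mxE big_ord1 !mxE pevalE.
  rewrite (sum_msupp _ (msize_le_half_degree (g i))) mulr_suml.
  apply: eq_bigr => z _; rewrite (pm_atE _ (mdeg_block_lt _ _ _ _)) //.
  by rewrite /dirac_moments /= !monomial_funD !mulrA.
apply: psd_scale.
  have [->|i0] := eqVneq i ord0; last exact: fx.
  by rewrite g0 /peval rmorph1.
have := psd_conj v^T (psd_scalar1 R 1).
by rewrite mulmx1 trmxK.
Qed.

End CoefficientMatrices.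

(** * Row sums of the constraint matrices *)

Section RowSums.
Variable R : realType.

Lemma row_sum_le_mxdiag q (p_ : 'I_q -> nat) (B : forall i, 'M[R]_(p_ i)) (c : R) :
  (forall i, row_sum_le (B i) c) -> row_sum_le (\mxdiag_i B i) c.
Proof.
move=> hB r; have -> : \sum_s `|(\mxdiag_i B i) r s| =
    \sum_j \sum_(s : 'I_(p_ j)) `|(if tagnat.sig1 r == j
      then conform_mx 0 (B (tagnat.sig1 r)) else 0) (tagnat.sig2 r) s|.
  rewrite [RHS]sig_big_dep (reindex _ tagnat.sig_bij_on) /=.
  by apply: eq_bigr => s _; rewrite mxE.
rewrite (bigD1 (tagnat.sig1 r)) //= eqxx conform_mx_id [X in _ + X]big1 ?addr0.
  exact: hB.
move=> j; rewrite eq_sym => /negbTE ->; apply: big1 => s _.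
by rewrite mxE normr0.
Qed.

Lemma sum_eq_inj_le1 (I : finType) (T : eqType) (h : I -> T) (c : T) :
  injective h -> \sum_i (h i == c)%:R <= 1 :> R.
Proof.
move=> hI; have [/existsP[i /eqP hi]|/existsPn none] := boolP [exists i, h i == c].
  rewrite (bigD1 i) //= hi eqxx big1 ?addr0 // => j ji.
  by rewrite -hi (inj_eq hI) (negbTE ji).
by rewrite big1 // => i _; rewrite (negbTE (none i)).
Qed.

Lemma mnth_inj n t : injective (@mnth n t).
Proof. by move=> i j e; apply: enum_val_inj; apply: val_inj. Qed.

Variables (n m : nat) (g : 'I_m.+1 -> mpoly n R) (k : nat).

(** For a fixed row and a fixed [z], at most one column index completes the sum to [c], so each
    coefficient of [g_i] is counted at most once. *)
Lemma row_sum_le_coef_block i c :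
  row_sum_le (@coef_block R n m g k i c) (coef_l1norm (g i)).
Proof.
move=> r; apply: (@le_trans _ _ (\sum_s \sum_(z : bmultinom n (2 * half_degree (g i)).+1)
    `|mcoeff z (g i)| * (mnm_add z (mnm_add (mnth r) (mnth s)) == c)%:R)).
  apply: ler_sum => s _; rewrite coef_blockE; apply: le_trans (ler_norm_sum _ _ _) _.
  by apply: ler_sum => z _; rewrite normrM normr_nat.
rewrite exchange_big /= /coef_l1norm.
(* Writing the absolute value as sign times coefficient gives the shape that [sum_msupp] expects. *)
under [leRHS]eq_bigr do rewrite normrEsg mulrC.
rewrite (sum_msupp (fun z => Num.sg (mcoeff z (g i))) (msize_le_half_degree (g i))).
apply: ler_sum => z _; rewrite -mulr_sumr [leRHS]mulrC -normrEsg.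
rewrite ler_piMr // sum_eq_inj_le1 // => s s'.
by rewrite !addmA => /addmI /mnth_inj.
Qed.

Hypothesis g0 : g ord0 = 1.
Hypothesis hb : forall i, i != ord0 -> coef_l1norm (g i) <= 1.

Lemma row_sum_le_Bgmx c : row_sum_le (Bgmx g k c) 1.
Proof.
apply: row_sum_le_mxdiag => i r.
apply: le_trans (@row_sum_le_coef_block i c r) _.
have [->|] := eqVneq i ord0; last exact: hb.
rewrite /coef_l1norm g0 msupp1 big_seq1 mcoeff1.
by rewrite normr_nat lern1 leq_b1.
Qed.

Lemma row_sum_le_con_mx c : row_sum_le (con_mx g k c) 1.
Proof.
move=> r; rewrite big_split_ord /= /con_mx.
case: (split_ordP r) => r' ->.
  under eq_bigr do rewrite block_mxEul.
  under [X in _ + X]eq_bigr do rewrite block_mxEur mxE normr0.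
  by rewrite big1_eq addr0; exact: row_sum_le_Bgmx.
under eq_bigr do rewrite block_mxEdl mxE normr0.
under [X in _ + X]eq_bigr do rewrite block_mxEdr mxE normr0.
by rewrite !big1_eq addr0.
Qed.

Lemma sym_con_mx c : (con_mx g k c)^T = con_mx g k c.
Proof. by rewrite tr_block_mx !trmx0 sym_Bgmx. Qed.

Lemma mxtrace_con_mx_mul c (P : 'M[R]_(\sum_i block_size g k i + 1)) :
  \tr (con_mx g k c *m P) = \tr (Bgmx g k c *m ulsubmx P).
Proof.
rewrite -{1}(submxK P) mulmx_block !mul0mx !addr0 mxtrace_block mxtrace0 addr0.
by [].
Qed.

End RowSums.

(** * Integrals of polynomials through moments *)

Section MomentIntegrals.
Variables (R : realType) (n : nat).
Implicit Types (p : mpoly n R) (x : n.-tuple R).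

Lemma monomial_fun0 x : monomial_fun mnm0 x = 1 :> R.
Proof. by rewrite /monomial_fun mpolyX0 /peval rmorph1. Qed.

Lemma monomial_fun1 i x : monomial_fun (mnm1 i) x = tnth x i :> R.
Proof. by rewrite /monomial_fun /peval mevalXU. Qed.

Lemma Rintegral_sum d (T : measurableType d) (mu : {measure set T -> \bar R})
    (I : Type) (s : seq I) (h : I -> T -> R) :
  (forall i, mu.-integrable setT (fun w => (h i w)%:E)) ->
  Rintegral mu setT (fun w => \sum_(i <- s) h i w) =
  \sum_(i <- s) Rintegral mu setT (h i).
Proof.
move=> hi; elim: s => [|i s IH].
  rewrite big_nil; under eq_Rintegral do rewrite big_nil.
  by rewrite Rintegral_cst // mul0r.
under eq_Rintegral do rewrite big_cons.
rewrite big_cons.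
have int_sum : mu.-integrable setT (EFin \o (fun w => \sum_(j <- s) h j w)).
  have -> : EFin \o (fun w => \sum_(j <- s) h j w) =
      (fun w => \sum_(j <- s) (h j w)%:E)%E.
    by apply/funext => w; rewrite /= -sumEFin.
  exact: integrable_sum.
rewrite -IH; exact: (RintegralD measurableT (hi i) int_sum).
Qed.

Variables (mu : {measure set (n.-tuple R) -> \bar R}) (k : nat).
Hypothesis mom : finite_moments mu (2 * k).

Lemma Rintegral_peval p : (mmeasure (@mdeg n) p <= (2 * k).+1)%N ->
  Rintegral mu setT (peval p) =
  \sum_(c : bmultinom n (2 * k).+1) mcoeff c p * moments mu k c.
Proof.
move=> hp.
have -> : peval p = fun x => \sum_(c : bmultinom n (2 * k).+1)
    mcoeff c p * monomial_fun c x.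
  by apply/funext => x; rewrite pevalE (sum_msupp _ hp).
rewrite Rintegral_sum => [|c].
  by apply: eq_bigr => c _; rewrite RintegralZl //; exact: mom.
under eq_fun do rewrite EFinM.
by apply: integrableZl => //; exact: mom.
Qed.

End MomentIntegrals.

(** * The sum of the nonconstant monomials at a point of small norm *)

Section MonomialSum.
Variables (R : realType) (n : nat) (x : n.-tuple R) (r : R).
Hypotheses (x_le : point_l1norm x <= r) (r_lt1 : r < 1).

(** Splitting off one variable from each nonconstant monomial gives [E <= r (1 + E)] for the sum
    [E], which is then solved for [E]. *)
Lemma sum_monomial_le T :
  \sum_(c : bmultinom n T.+1 | c != bm0) `|monomial_fun c x| <= r / (1 - r).
Proof.
set E := \sum_(c | _) _.
have r0 : 0 <= r by apply: le_trans x_le; apply: sumr_ge0.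
(* The contribution to [c] of the factorization [x^c = x_i x^e]. *)
pose F i (e c : bmultinom n T.+1) :=
  (mnm_add (mnm1 i) e == bmnm c)%:R * (`|tnth x i| * `|monomial_fun e x|).
have F0 i e c : 0 <= F i e c by rewrite mulr_ge0 ?ler0n ?mulr_ge0.
have E_le : E <= \sum_c \sum_i \sum_e F i e c.
  rewrite /E [leLHS]big_mkcond /=; apply: ler_sum => c _.
  case: ifPn => [c0|_]; last by do 2!apply: sumr_ge0 => ? _.
  have /existsP[i ci] : [exists i, bmnm c i != 0%N].
    apply: contraNT c0 => /existsPn h; rewrite bmeqP; apply/eqP/mnmP => i.
    by rewrite mnm0E; apply/eqP; have := h i; rewrite negbK.
  have le1c : mpoly.lem (mnm1 i) c by rewrite lep1mP.
  have lt_c' : (mdeg (mnm_sub c (mnm1 i)) < T.+1)%N.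
    by apply: leq_ltn_trans (bmdeg c); rewrite -{2}(submK le1c) mdegD leq_addr.
  rewrite (bigD1 i) //= -[leLHS]addr0 lerD ?sumr_ge0 //; last first.
    by move=> j _; apply: sumr_ge0.
  rewrite (bigD1 (BMultinom lt_c')) //= -[leLHS]addr0 lerD ?sumr_ge0 //.
  rewrite /F /= addmC submK // eqxx mul1r -normrM -(monomial_fun1 i x).
  by rewrite -monomial_funD addmC submK.
have E_le2 : E <= r * (1 + E).
  apply: le_trans E_le _; rewrite exchange_big /=.
  apply: (@le_trans _ _ (\sum_i `|tnth x i| * (1 + E))); last first.
    by rewrite -mulr_suml ler_wpM2r // addr_ge0 // sumr_ge0.
  apply: ler_sum => i _; rewrite exchange_big /=.
  have -> : 1 + E = \sum_(e : bmultinom n T.+1) `|monomial_fun e x|.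
    by rewrite (bigD1 bm0) //= monomial_fun0 normr1.
  rewrite mulr_sumr; apply: ler_sum => e _; rewrite -mulr_suml ler_piMl ?mulr_ge0 //.
  under eq_bigr do rewrite eq_sym.
  by apply: sum_eq_inj_le1 => c c' h; apply: val_inj.
rewrite ler_pdivlMr ?subr_gt0 //; lra.
Qed.

End MonomialSum.

(** * Positive semidefinite two-by-two block matrices *)

Section BlockPsd.
Variables (R : realType) (p q : nat).

Lemma psd_ulsubmx (P : 'M[R]_(p + q)) : psd P -> psd (ulsubmx P).
Proof.
move=> pP; have := psd_conj (row_mx 1%:M 0 : 'M[R]_(p, p + q)) pP.
rewrite -{1}(submxK P) mul_row_block !mul1mx !mul0mx !addr0.
by rewrite tr_row_mx mul_row_col trmx1 trmx0 mulmx1 mulmx0 addr0.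
Qed.

Lemma psd_block_diag (A : 'M[R]_p) (B : 'M[R]_q) :
  psd A -> psd B -> psd (block_mx A 0 0 B).
Proof.
move=> pA pB; split; first by rewrite tr_block_mx !trmx0 pA.1 pB.1.
move=> u; rewrite -(hsubmxK u) mul_row_block !mulmx0 addr0 add0r tr_row_mx.
rewrite mul_row_col.
have addE (M1 M2 : 'M[R]_1) : (M1 + M2) 0 0 = M1 0 0 + M2 0 0 by rewrite mxE.
by rewrite addE; apply: addr_ge0; [exact: pA.2|exact: pB.2].
Qed.

End BlockPsd.

(** * The certificate as a density matrix, and weak duality *)

Section Relaxation.
Variables (R : realType) (n m k : nat).
Variables (f : mpoly n R) (g : 'I_m.+1 -> mpoly n R).
Hypotheses (g0 : g ord0 = 1) (hkf : (half_degree f <= k)%N).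
Hypothesis hkg : forall i, (half_degree (g i) <= k)%N.

Let msize_f : (mmeasure (@mdeg n) f <= (2 * k).+1)%N.
Proof.
apply: leq_trans (msize_le_half_degree f) _.
by rewrite ltnS leq_mul2l hkf orbT.
Qed.

Lemma sum_block_size_gt0 : (0 < \sum_i block_size g k i)%N.
Proof.
rewrite (bigD1 ord0) //= addn_gt0; apply/orP; left.
by apply/card_gt0P; exists bm0.
Qed.

Let msize_subC lam : (mmeasure (@mdeg n) (f - mpolyC n lam) <= (2 * k).+1)%N.
Proof.
apply: leq_trans (mmeasureD_le _ _ _) _; rewrite geq_max msize_f mmeasureN mmeasureC.
by case: eqP.
Qed.

Lemma mxtrace_sos_le1 (mu : {measure set (n.-tuple R) -> \bar R}) lamlow lam
    (G : forall i, 'M[R]_(block_size g k i)) :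
  finite_moments mu (2 * k) -> 0 < lambda_min (Dmx g (moments mu k)) ->
  Rintegral mu setT (fun x => peval f x - lamlow)
    / lambda_min (Dmx g (moments mu k)) <= 1 ->
  lamlow <= lam -> sos_feasible f lam G -> \tr (\mxdiag_i G i) <= 1.
Proof.
move=> mom pos ha le_lam [pG fG]; set D := Dmx g _ in pos ha.
have tD : \tr (D *m \mxdiag_i G i) =
    Rintegral mu setT (peval (f - mpolyC n lam)).
  rewrite (Rintegral_peval mom (msize_subC lam)) /D Dmx_sum // mulmx_suml raddf_sum.
  apply: eq_bigr => c _; rewrite /= -scalemxAl mxtraceZ fG sos_mcoeff //.
  by rewrite mulrC.
have le_int : Rintegral mu setT (peval (f - mpolyC n lam)) <=
    Rintegral mu setT (fun x => peval f x - lamlow).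
  have -> : (fun x => peval f x - lamlow) = peval (f - mpolyC n lamlow).
    by apply/funext => x; rewrite /peval mevalB mevalC.
  (* The two integrands differ only in the constant coefficient, so the gap is [lam - lamlow] times
     the nonnegative moment of order zero. *)
  rewrite !(Rintegral_peval mom) // -subr_ge0 -sumrB (bigD1 bm0) //= big1 ?addr0.
    rewrite !mcoeffB !mcoeffC eqxx !mulr1 -mulrBl.
    rewrite opprB addrC addrA subrK mulr_ge0 ?subr_ge0 // /moments; apply: Rintegral_ge0 => x _.
    by rewrite -[peval _ _]/(monomial_fun mnm0 x) monomial_fun0.
  move=> c c0; rewrite !mcoeffB !mcoeffC.
  by rewrite bmeqP in c0; rewrite (negbTE c0) !mulr0 !subr0 subrr.
have := lambda_min_mxtrace_le sum_block_size_gt0 (sym_Dmx g (moments mu k)) pG.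
rewrite -/D tD => le1.
rewrite -(ler_pM2l pos) mulr1; apply: (le_trans le1); apply: (le_trans le_int).
by move: ha; rewrite ler_pdivrMr // mul1r.
Qed.

Definition sos_point (G : forall i, 'M[R]_(block_size g k i)) :
    'M[R]_(\sum_i block_size g k i + 1) :=
  block_mx (\mxdiag_i G i) 0 0 (1 - \tr (\mxdiag_i G i))%:M.

Lemma psd_sos_point lam (G : forall i, 'M[R]_(block_size g k i)) :
  sos_feasible f lam G -> \tr (\mxdiag_i G i) <= 1 -> psd (sos_point G).
Proof.
move=> [pG _] tG; apply: psd_block_diag => //.
by rewrite -scalemx1; apply: psd_scale; [rewrite subr_ge0|exact: psd_scalar1].
Qed.

Lemma mxtrace_sos_point (G : forall i, 'M[R]_(block_size g k i)) :
  \tr (sos_point G) = 1.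
Proof. by rewrite mxtrace_block mxtrace_scalar mulr1n addrC subrK. Qed.

Lemma mxtrace_con_mx_sos_point lam (G : forall i, 'M[R]_(block_size g k i)) c :
  sos_feasible f lam G ->
  \tr (con_mx g k c *m sos_point G) = mcoeff c (f - mpolyC n lam).
Proof.
by move=> [_ ->]; rewrite mxtrace_con_mx_mul block_mxKul sos_mcoeff.
Qed.

(* Weak duality against the Dirac measure at [x], with a violation [eps] in each
   constraint. *)
Lemma con_approx_feasible (x : n.-tuple R) (r eps lam : R)
    (P : 'M[R]_(\sum_i block_size g k i + 1)) :
  0 <= eps -> r < 1 -> point_l1norm x <= r -> feasible_set g x -> psd P ->
  (forall c : nonzero_index n k,
     `|\tr (con_mx g k (val c) *m P) - mcoeff (val c) f| <= eps) ->
  \tr (con_mx g k mnm0 *m P) <= lam + eps ->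
  mcoeff mnm0 f - peval f x <= lam + eps * (1 + r / (1 - r)).
Proof.
move=> eps0 r1 xr fx pP hP hC.
(* Expanded by [Dmx_sum], this says that the values [tr (A_c P)] weighted by [x^c] have a
   nonnegative sum. *)
have := mxtrace_mul_psd_ge0 (psd_Dmx_dirac hkg g0 fx) (psd_ulsubmx pP).
rewrite Dmx_sum // mulmx_suml raddf_sum /=.
under eq_bigr do rewrite -scalemxAl mxtraceZ -mxtrace_con_mx_mul.
rewrite (bigD1 bm0) //= {1}/dirac_moments monomial_fun0 mul1r => ge0.
have fxE : peval f x = mcoeff mnm0 f +
    \sum_(c : bmultinom n (2 * k).+1 | c != bm0) monomial_fun c x * mcoeff c f.
  rewrite pevalE (sum_msupp _ msize_f) (bigD1 bm0) //= monomial_fun0 mulr1.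
  by congr (_ + _); apply: eq_bigr => c _; rewrite mulrC.
(* Replacing each constraint value by [f_c] costs at most [eps |x^c|]. *)
have le_sum : \sum_(c : bmultinom n (2 * k).+1 | c != bm0)
      dirac_moments x c * \tr (con_mx g k c *m P) <=
    \sum_(c : bmultinom n (2 * k).+1 | c != bm0) monomial_fun c x * mcoeff c f +
    eps * (r / (1 - r)).
  apply: (@le_trans _ _ (\sum_(c : bmultinom n (2 * k).+1 | c != bm0)
      (monomial_fun c x * mcoeff c f + `|monomial_fun c x| * eps))).
    apply: ler_sum => c c0; rewrite -lerBlDl -mulrBr.
    apply: le_trans (ler_norm _) _; rewrite normrM ler_wpM2l //.
    exact: (hP (exist _ c c0)).
  rewrite big_split /= lerD2l -mulr_suml mulrC ler_wpM2l //.
  exact: sum_monomial_le.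
rewrite fxE; lra.
Qed.

End Relaxation.

(** * Bisection with an exact negative and an approximate positive answer *)

Section BinarySearchCorrect.
Variables (R : realType) (N : nat) (I : finType).
Variables (C : 'M[R]_N) (A : I -> 'M[R]_N) (b : I -> R) (lmin lmax eps : R).
Variables (v delta : R).
Hypotheses (eps_gt0 : 0 < eps) (lmin_lt : lmin < lmax).
Hypotheses (lmin_le : lmin <= v) (le_lmax : v <= lmax + delta).
Hypothesis infeasible : forall lam,
  hu_output eps (bs_mx C A) (bs_rhs b lam) false -> lam <= v.
Hypothesis feasible : forall lam,
  hu_output eps (bs_mx C A) (bs_rhs b lam) true -> v <= lam + delta.

(** The bracket [lo <= v <= hi + delta] is invariant while its length halves. The error [delta] of a
    positive answer is paid once, since it does not accumulate over the iterations. *)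
Lemma bs_output_bounds l : bs_output C A b lmin lmax eps l ->
  l <= v <= l + (eps + delta).
Proof.
move=> [hi st].
have [h1 h2 h3] : [/\ l <= v, v <= hi + delta &
    hi - l = (lmax - lmin) / 2 ^+ bs_steps lmin lmax eps].
  elim: st => [|t lo hi' _ [h1 h2 h3] _ out|t lo hi' _ [h1 h2 h3] _ out].
  - by rewrite expr0 divr1.
  - split=> //; first exact: infeasible.
    by rewrite exprSr invfM mulrA -h3; field.
  - split=> //; first exact: feasible.
    by rewrite exprSr invfM mulrA -h3; field.
have d0 : 0 < (lmax - lmin) / eps by rewrite divr_gt0 // subr_gt0.
(* The number of steps is at least the base-two logarithm of [(lmax - lmin) / eps]. *)
have : (lmax - lmin) / 2 ^+ bs_steps lmin lmax eps <= eps.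
  rewrite ler_pdivrMr ?exprn_gt0 // mulrC -ler_pdivrMr //.
  have ln2 : 0 < ln (2 : R) by rewrite ln_gt0 // ltr1n.
  have : ln ((lmax - lmin) / eps) <= ln (2 ^+ bs_steps lmin lmax eps).
    rewrite lnXn // -[leRHS]mulr_natl -ler_pdivrMr //; exact: le_ceil_nat.
  by rewrite ler_ln ?posrE ?exprn_gt0.
rewrite -h3 h1 /= => h4; clear st h3; lra.
Qed.

End BinarySearchCorrect.

(** * Assembly of the error bound for [CON] *)

Theorem theorem2 (R : realType) (n m k : nat)
    (f : mpoly n R) (g : 'I_m.+1 -> mpoly n R)
    (eps r lamlow : R) (mu : {measure set (n.-tuple R) -> \bar R})
    (xstar a : n.-tuple R) (lamk_eps : R)
    (eps_gt0 : 0 < eps)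
    (g0 : g ord0 = 1)
    (hkf : (half_degree f <= k)%N)
    (hkg : forall i, (half_degree (g i) <= k)%N)
    (ha_low : (lamlow%:E <= sos_value f g k)%E)
    (ha_supp : mu (~` feasible_set g) = 0%E)
    (ha_mom : finite_moments mu (2 * k))
    (ha_pos : 0 < lambda_min (Dmx g (moments mu k)))
    (ha : Rintegral mu setT (fun x => peval f x - lamlow)
            / lambda_min (Dmx g (moments mu k)) <= 1)
    (hb : forall i, i != ord0 -> coef_l1norm (g i) <= 1)
    (hdual : strong_duality f g k)
    (hexact : sos_value f g k = fstar f g)
    (xstar_feas : feasible_set g xstar)
    (xstar_opt : forall x, feasible_set g x -> peval f xstar <= peval f x)
    (hr : 0 < r < 1)
    (xstar_l1 : point_l1norm xstar <= r)
    (a_feas : feasible_set g a)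
    (hbs : mcoeff mnm0 f - peval f a < mcoeff mnm0 f - lamlow)
    (hcon : con_output f g k eps lamlow a lamk_eps) :
  (0 <= lamk_eps%:E - sos_value f g k <= (eps * (2 + r / (1 - r)))%:E)%E.
Proof.
have fE : sos_value f g k = (peval f xstar)%:E.
  rewrite hexact; apply/eqP; rewrite eq_le; apply/andP; split.
    by apply: ereal_inf_lbound; exists xstar.
  by apply: le_ereal_inf_tmp => _ [x fx <-]; rewrite lee_fin xstar_opt.
have [_ [lam [G [sosG lamE]]] _] := hdual.
have lam_eq : lam = peval f xstar by move: lamE; rewrite fE => -[].
have le_lam : lamlow <= lam by move: ha_low; rewrite -lamE lee_fin.
have tG := mxtrace_sos_le1 hkf hkg ha_mom ha_pos ha le_lam sosG.
have [r0 r1] := andP hr.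
(* The slack entry makes the size at least two, so that [ln N] is positive. *)
have N_gt1 : (1 < \sum_i block_size g k i + 1)%N.
  by rewrite addn1 ltnS; exact: sum_block_size_gt0.
have [l out ->] := hcon.
set f0 := mcoeff mnm0 f in hbs out *.
pose A (c : nonzero_index n k) := con_mx g k (val c).
pose b (c : nonzero_index n k) := mcoeff (val c) f.
have symA j : (bs_mx (con_mx g k mnm0) A j)^T = bs_mx (con_mx g k mnm0) A j.
  by case: j => [[c|c]|[]] /=; rewrite ?linearN /= sym_con_mx.
have normA j : row_sum_le (bs_mx (con_mx g k mnm0) A j) 1.
  by case: j => [[c|c]|[]] /=; try apply: row_sum_leN; exact: row_sum_le_con_mx.
pose delta := eps * (1 + r / (1 - r)).
have /andP[lo hi] : l <= f0 - lam <= l + (eps + delta).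
  apply: (bs_output_bounds eps_gt0 hbs _ _ _ _ out).
  - by rewrite lerD2l lerN2 lam_eq xstar_opt.
  - have : 0 <= delta.
      by rewrite mulr_ge0 ?(ltW eps_gt0) // addr_ge0 // divr_ge0 ?subr_ge0 ?(ltW r0) ?(ltW r1).
    by move=> delta0; rewrite (@le_trans _ _ (f0 - lamlow)) ?lerDl // lerD2l lerN2.
  (* For a threshold above the value, the density matrix built from the certificate would be
     feasible, against the negative answer. *)
  - move=> mid no; rewrite leNgt; apply/negP => lt_mid.
    apply: (hu_output_false eps_gt0 N_gt1 symA normA no
      (psd_sos_point sosG tG) (mxtrace_sos_point G)).
    have trE c := mxtrace_con_mx_sos_point c sosG.
    have trA (c : nonzero_index n k) : \tr (A c *m sos_point G) = b c.
      rewrite trE // mcoeffB mcoeffC.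
      by have := valP c; rewrite bmeqP => /negbTE ->; rewrite mulr0 subr0.
    have leA c : \tr (A c *m sos_point G) <= b c by rewrite le_eqVlt trA eqxx.
    case=> [[c|c]|[]]; first exact: leA.
      change (\tr (- A c *m sos_point G) <= - b c).
      by rewrite mulNmx raddfN lerN2 /= le_eqVlt trA eqxx.
    change (\tr (con_mx g k mnm0 *m sos_point G) <= mid).
    by rewrite trE mcoeffB mcoeffC eqxx mulr1 ltW.
  - move=> mid yes.
    have [P [pP tP hP]] := hu_output_true N_gt1 symA normA yes.
    rewrite lam_eq; apply: (con_approx_feasible g0 hkf hkg (ltW eps_gt0) r1
      xstar_l1 xstar_feas pP) => [c|]; last exact: (hP (inr tt)).
    (* The two opposite inequalities encoding each equation give a two-sided violation bound. *)
    have h1 : \tr (A c *m P) <= b c + eps := hP (inl (inl c)).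
    have h2 : \tr (- A c *m P) <= - b c + eps := hP (inl (inr c)).
    rewrite mulNmx raddfN /= in h2.
    rewrite ler_norml lerBlDr [eps + _]addrC; apply/andP; split=> //.
    by rewrite lerBrDr -lerN2 opprD opprK addrC.
rewrite fE -EFinB !lee_fin -lam_eq.
apply/andP; split; first by rewrite addrAC subr_ge0.
rewrite /delta in hi; clear -hi; lra.
Qed.
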